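(* Let $p>1$ be an integer. For every $\alpha\in\Omega_p^{\mathrm{even}}$, the multipliers $\Psi_\alpha$ and $\omega_\alpha$ on $\Gamma_p$ are cohomologous. In particular, $C^*(\Gamma_p,\Psi_\alpha)\cong C^*(\Gamma_p,\omega_\alpha)$.
   Context: $\mathbb N=\{0,1,2,\dots\}$; $\mathbb T$ is the unit circle. $\Gamma_p=\mathbb Z[1/p]\times\mathbb Z[1/p]$ as a discrete additive group, where $\mathbb Z[1/p]=\{j/p^k:j\in\mathbb Z,k\in\mathbb N\}$; elements are always written as $j/p^k$ with the exponent $k\in\mathbb N$ minimal. $\Omega_p^{\mathrm{even}}$ is the set of real sequences $(\alpha_n)_{n\in\mathbb N}$ such that for every $n$ there is $x_n\in2\mathbb Z$ with $p\alpha_{n+1}=\alpha_n+x_n$. For $\alpha\in\Omega_p^{\mathrm{even}}$, $$\Psi_\alpha\left(\left(\tfrac{j_1}{p^{k_1}},\tfrac{j_2}{p^{k_2}}\right),\left(\tfrac{j_3}{p^{k_3}},\tfrac{j_4}{p^{k_4}}\right)\right)=e^{2\pi i\,\alpha_{k_1+k_4}j_1j_4},$$ $$\omega_\alpha\left(\left(\tfrac{j_1}{p^{k_1}},\tfrac{j_2}{p^{k_2}}\right),\left(\tfrac{j_3}{p^{k_3}},\tfrac{j_4}{p^{k_4}}\right)\right)=e^{\pi i(\alpha_{k_1+k_4}j_1j_4-\alpha_{k_2+k_3}j_2j_3)}.$$ A multiplier on a discrete additive group $G$ is a function $\omega:G\times G\to\mathbb T$ with $\omega(x,y)\omega(x+y,z)=\omega(x,y+z)\omega(y,z)$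 and $\omega(x,0)=1=\omega(0,x)$. Multipliers $\omega,\omega'$ on $G$ are cohomologous if there is a map $\rho:G\to\mathbb T$ with $\omega(s,t)=\rho(s)\rho(t)\overline{\rho(s+t)}\,\omega'(s,t)$ for all $s,t$. $C^*(G,\omega)$ is the twisted group $C^*$-algebra: the completion of $\ell^1(G)$, with product $(f*_\omega g)(x)=\sum_yf(y)g(x-y)\omega(y,x-y)$ and involution $f^*(x)=\overline{\omega(x,-x)f(-x)}$, in the norm of the regular representation $(L_\omega(x)f)(y)=\omega(x,y-x)f(y-x)$ on $\ell^2(G)$. *)

(* Defs.v *)
(* MathComp / MathComp-Analysis, classical logic; the reals are an arbitrary
   realType R and the complex numbers are R[i]. *)
From HB Require Import structures.
From mathcomp Require Import all_boot all_order all_algebra.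
From mathcomp Require Import complex ring_quotient generic_quotient.
From mathcomp Require Import boolp classical_sets functions cardinality fsbigop.
From mathcomp Require Import reals ereal topology normedtype esum trigo sequences.
From mathcomp Require Import ring lra.

Set Implicit Arguments.
Unset Strict Implicit.
Unset Printing Implicit Defensive.

Import Order.TTheory GRing.Theory Num.Theory.
Import numFieldNormedType.Exports.
Local Open Scope classical_set_scope.
Local Open Scope ring_scope.
Local Open Scope complex_scope.
Local Notation "z ^*" := (conjc z) : ring_scope.

Section NonnegativeSums.
Context {R : realType}.
Implicit Types T : choiceType.

(* Sums of nonnegative families over an arbitrary (possibly uncountable)
   index type, taken from the extended-real esum. *)
Definition psummable {T} (a : T -> R) : Prop :=
  (forall x, 0 <= a x) /\ (\esum_(x in [set: T]) (a x)%:E < +oo)%E.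

Definition psum {T} (a : T -> R) : R := fine (\esum_(x in [set: T]) (a x)%:E).

Lemma psumE T (a : T -> R) : psummable a ->
  (\esum_(x in [set: T]) (a x)%:E)%E = (psum a)%:E.
Proof.
move=> [a0 afin]; rewrite /psum fineK// ge0_fin_numE//.
by apply: esum_ge0 => x _; rewrite lee_fin.
Qed.

Lemma psumP T (a : T -> R) r : (forall x, 0 <= a x) ->
  (\esum_(x in [set: T]) (a x)%:E)%E = r%:E -> psummable a /\ psum a = r.
Proof. by move=> a0 e; rewrite /psummable /psum e ltry. Qed.

Lemma psum_ge0 T (a : T -> R) : psummable a -> 0 <= psum a.
Proof.
move=> pa; rewrite -lee_fin -psumE//; apply: esum_ge0 => x _.
by rewrite lee_fin; case: pa.
Qed.

Lemma le_psummable T (a b : T -> R) :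
  (forall x, 0 <= a x) -> (forall x, a x <= b x) -> psummable b -> psummable a.
Proof.
move=> a0 ab [b0 bfin]; split=> //; apply: le_lt_trans bfin.
by apply: le_esum => x _; rewrite lee_fin.
Qed.

Lemma le_psum T (a b : T -> R) :
  (forall x, 0 <= a x) -> (forall x, a x <= b x) -> psummable b ->
  psum a <= psum b.
Proof.
move=> a0 ab pb; have pa := le_psummable a0 ab pb.
by rewrite -lee_fin -!psumE//; apply: le_esum => x _; rewrite lee_fin.
Qed.

Lemma psumD T (a b : T -> R) : psummable a -> psummable b ->
  psummable (fun x => a x + b x) /\ psum (fun x => a x + b x) = psum a + psum b.
Proof.
move=> pa pb; apply: psumP; first by move=> x; rewrite addr_ge0; case: pa; case: pb.
rewrite EFinD -!psumE// -esumD// => [x _|x _]; rewrite lee_fin;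
  by [case: pa | case: pb].
Qed.

Lemma esumZ_le T (k : R) (a : T -> R) : 0 <= k -> psummable a ->
  (\esum_(x in [set: T]) (k * a x)%:E <= k%:E * \esum_(x in [set: T]) (a x)%:E)%E.
Proof.
move=> k0 pa; apply: ge_ereal_sup => _ /= [X [finX XT]] <-.
have -> : (\sum_(x \in X) (k * a x)%:E = k%:E * \sum_(x \in X) (a x)%:E)%E.
  rewrite !fsbig_finite//= ge0_sume_distrr//.
  by move=> i _; rewrite lee_fin; case: pa.
apply: lee_wpmul2l; first by rewrite lee_fin.
by apply: esum_ge; exists X.
Qed.

Lemma psumZ T (k : R) (a : T -> R) : 0 <= k -> psummable a ->
  psummable (fun x => k * a x) /\ psum (fun x => k * a x) = k * psum a.
Proof.
move=> k0 pa; have a0 : forall x, 0 <= a x by case: pa.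
have ka0 x : 0 <= k * a x by rewrite mulr_ge0.
have pka : psummable (fun x => k * a x).
  split=> //; apply: le_lt_trans (esumZ_le k0 pa) _.
  by rewrite psumE// -EFinM ltry.
split=> //; have [->|kN0] := eqVneq k 0.
  rewrite mul0r /psum esum1//.
  by move=> x _; rewrite mul0r.
apply/eqP; rewrite eq_le -lee_fin EFinM -!psumE// esumZ_le//=.
have kp : 0 < k by rewrite lt_neqAle eq_sym kN0.
rewrite -ler_pdivlMl// -lee_fin EFinM -!psumE//.
apply: le_trans (esumZ_le _ pka); last by rewrite invr_ge0.
by apply: le_esum => x _; rewrite mulKf.
Qed.

Lemma eq_psum T (a b : T -> R) : a =1 b -> psum a = psum b.
Proof. by move=> /funext->. Qed.

Lemma psum_term T (a : T -> R) x : psummable a -> a x <= psum a.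
Proof.
move=> pa; rewrite -lee_fin -psumE//; apply: esum_ge; exists [set x].
  by split=> //; exact: finite_set1.
by rewrite fsbig_set1.
Qed.

Lemma psum_reindex T T' (e : T -> T') (a : T' -> R) : bijective e ->
  psummable a -> psummable (a \o e) /\ psum (a \o e) = psum a.
Proof.
move=> be pa; apply: psumP => [x /=|]; first by case: pa.
rewrite -psumE//; apply/esym; apply: (@reindex_esum R T T' setT setT e (fun y => (a y)%:E)).
by rewrite setTT_bijective.
Qed.

Lemma esum_exchange T T' (a : T -> T' -> \bar R) :
  (forall x y, 0 <= a x y)%E ->
  (\esum_(x in [set: T]) \esum_(y in [set: T']) a x y =
   \esum_(y in [set: T']) \esum_(x in [set: T]) a x y)%E.
Proof.
move=> a0; rewrite !esum_esum//.
rewrite (@reindex_esum R _ _ (setT `*`` (fun _ : T' => setT)) _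
  (fun p : T' * T => (p.2, p.1)))//.
split=> //=.
- by move=> [x y] [x' y'] _ _ [-> ->].
- by move=> [x y] _; exists (y, x).
Qed.

Lemma psum_exchange T T' (a : T -> T' -> R) :
  (forall x, psummable (a x)) -> psummable (fun x => psum (a x)) ->
  [/\ forall y, psummable (a^~ y), psummable (fun y => psum (a^~ y)) &
      psum (fun y => psum (a^~ y)) = psum (fun x => psum (a x))].
Proof.
move=> pa ppa.
have a0 x y : 0 <= a x y by case: (pa x).
have pay y : psummable (a^~ y).
  apply: le_psummable ppa => // x; exact: psum_term.
have e : (\esum_(y in [set: T']) (psum (a^~ y))%:E)%E =
         (psum (fun x => psum (a x)))%:E.
  rewrite -psumE//; under eq_esum do rewrite -psumE//.
  rewrite esum_exchange//; last by move=> x y; rewrite lee_fin.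
  by apply: eq_esum => x _; rewrite psumE.
have pp0 y : 0 <= psum (a^~ y) by exact: psum_ge0.
by have [? ?] := psumP pp0 e.
Qed.

Lemma psum0 T (a : T -> R) : (forall x, a x = 0) -> psummable a /\ psum a = 0.
Proof.
move=> a0; apply: psumP => [x|]; first by rewrite a0.
by rewrite esum1// => x _; rewrite a0.
Qed.

Lemma psum1 T (a : T -> R) x0 : 0 <= a x0 -> (forall x, x != x0 -> a x = 0) ->
  psummable a /\ psum a = a x0.
Proof.
move=> a00 a0; apply: psumP => [x|].
  by have [->|/a0->] := eqVneq x x0.
rewrite (esumID [set x0])//; last first.
  by move=> x _; rewrite lee_fin; have [->|/a0->] := eqVneq x x0.
rewrite setTI esum_set1 ?lee_fin// esum1 ?adde0//.
by move=> x [_ /= /eqP xx0]; rewrite a0.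
Qed.

Lemma psum_CS T (a b : T -> R) : (forall x, 0 <= a x) -> (forall x, 0 <= b x) ->
  psummable (fun x => a x ^+ 2) -> psummable (fun x => b x ^+ 2) ->
  psummable (fun x => a x * b x) /\
  psum (fun x => a x * b x) ^+ 2 <=
    psum (fun x => a x ^+ 2) * psum (fun x => b x ^+ 2).
Proof.
move=> a0 b0 pa pb.
have amgm t x : 0 <= t -> (2 * t) * (a x * b x) <= t ^+ 2 * a x ^+ 2 + b x ^+ 2.
  by move=> _; rewrite -subr_ge0; have := sqr_ge0 (t * a x - b x); nra.
have pab : psummable (fun x => a x * b x).
  have [pp _] := psumD (psumZ (sqr_ge0 1) pa).1 pb.
  apply: le_psummable pp => x; first exact: mulr_ge0.
  have := amgm 1 x ler01; have := mulr_ge0 (a0 x) (b0 x); nra.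
split=> //; set P := psum _; set A := psum _; set B := psum _.
have main t : 0 <= t -> 2 * t * P <= t ^+ 2 * A + B.
  move=> t0; have t20 : 0 <= 2 * t by rewrite mulr_ge0.
  rewrite -(psumZ t20 pab).2 -(psumZ (sqr_ge0 t) pa).2.
  have [pp <-] := psumD (psumZ (sqr_ge0 t) pa).1 pb.
  apply: le_psum pp => x; last exact: amgm.
  by rewrite mulr_ge0// mulr_ge0.
have P0 : 0 <= P by exact: psum_ge0.
have A0 : 0 <= A by exact: psum_ge0.
have B0 : 0 <= B by exact: psum_ge0.
have [A00|AN0] := eqVneq A 0.
  suff -> : P = 0 by rewrite expr0n /= mulr_ge0.
  apply/eqP/negPn/negP => PN0.
  have Pp : 0 < P by rewrite lt_neqAle eq_sym PN0.
  have := main ((B + 1) / P).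
  rewrite A00 mulr0 add0r -mulrA -(mulrA _ _ P) mulVf// mulr1 divr_ge0//; last lra.
  by move=> /(_ isT); lra.
have Ap : 0 < A by rewrite lt_neqAle eq_sym AN0.
have := main (P / A) (divr_ge0 P0 A0).
have -> : (P / A) ^+ 2 * A = P ^+ 2 / A by field.
have -> : 2 * (P / A) * P = 2 * (P ^+ 2 / A) by field.
move=> h; have {h}: P ^+ 2 / A <= B by lra.
by rewrite ler_pdivrMr// mulrC.
Qed.

End NonnegativeSums.

Section ComplexSums.
Context {R : realType}.
Local Notation C := R[i].
Local Notation Re := (@complex.Re R).
Local Notation Im := (@complex.Im R).
Implicit Types T : choiceType.

(* The modulus as an element of R: the library's `|z| lives in R[i]. *)
Definition cabs (z : C) : R := Re `|z|.

(* Unconditional sums: positive part minus negative part, and then real plus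
   imaginary part. They are meaningful for absolutely summable families. *)
Definition rsum {T} (g : T -> R) : R :=
  psum (fun x => Num.max (g x) 0) - psum (fun x => Num.max (- g x) 0).

Definition csum {T} (f : T -> C) : C :=
  rsum (fun x => Re (f x)) +i* rsum (fun x => Im (f x)).

Definition csummable {T} (f : T -> C) : Prop := psummable (fun x => cabs (f x)).

Lemma cabsE z : (cabs z)%:C = `|z| :> C.
Proof. by rewrite /cabs normc_def. Qed.

Lemma cabs_ge0 z : 0 <= cabs z.
Proof. by rewrite -ler0c cabsE. Qed.

Lemma cabsM z w : cabs (z * w) = cabs z * cabs w.
Proof. by apply: complexI; rewrite rmorphM/= !cabsE normrM. Qed.

Lemma cabsD z w : cabs (z + w) <= cabs z + cabs w.
Proof. by rewrite -lecR rmorphD/= !cabsE ler_normD. Qed.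

Lemma cabsN z : cabs (- z) = cabs z.
Proof. by apply: complexI; rewrite !cabsE normrN. Qed.

Lemma cabs0 : cabs 0 = 0.
Proof. by apply: complexI; rewrite cabsE normr0. Qed.

Lemma cabs_eq0 z : (cabs z == 0) = (z == 0).
Proof. by rewrite -(inj_eq (@complexI R)) cabsE normr_eq0. Qed.

Lemma cabs_sqrE z : cabs z ^+ 2 = Re z ^+ 2 + Im z ^+ 2.
Proof. by apply: complexI; rewrite add_Re2_Im2 -cabsE rmorphXn. Qed.

Lemma cabs_real (x : R) : cabs x%:C = `|x|.
Proof.
rewrite /cabs normc_def /= expr0n /= addr0 sqrtr_sqr //.
Qed.

Lemma cabs_conj z : cabs z^* = cabs z.
Proof. by rewrite /cabs !normc_def; case: z => a b /=; rewrite sqrrN. Qed.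

Lemma mulcJ z : z * z^* = (cabs z ^+ 2)%:C.
Proof.
rewrite cabs_sqrE; case: z => a b; apply/eqP; rewrite eq_complex /=.
by apply/andP; split; apply/eqP; ring.
Qed.

Lemma ReD (z w : C) : Re (z + w) = Re z + Re w.
Proof. by case: z; case: w. Qed.
Lemma ImD (z w : C) : Im (z + w) = Im z + Im w.
Proof. by case: z; case: w. Qed.
Lemma ReM (z w : C) : Re (z * w) = Re z * Re w - Im z * Im w.
Proof. by case: z; case: w. Qed.
Lemma ImM (z w : C) : Im (z * w) = Re z * Im w + Im z * Re w.
Proof. by case: z; case: w. Qed.

Lemma Re_le z : `|Re z| <= cabs z.
Proof.
rewrite -(@ler_pXn2r _ 2)// ?nnegrE ?cabs_ge0//.
by rewrite real_normK ?num_real// cabs_sqrE lerDl sqr_ge0.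
Qed.

Lemma Im_le z : `|Im z| <= cabs z.
Proof.
rewrite -(@ler_pXn2r _ 2)// ?nnegrE ?cabs_ge0//.
by rewrite real_normK ?num_real// cabs_sqrE lerDr sqr_ge0.
Qed.

Lemma cabs_phase z : exists2 u : C, cabs u = 1 & u * z = (cabs z)%:C.
Proof.
have [->|z0] := eqVneq z 0.
  by exists 1; rewrite ?mulr0 ?cabs0// /cabs normr1.
exists (z^* / (cabs z)%:C); last first.
  rewrite mulrAC [_ * z]mulrC mulcJ expr2 rmorphM /= mulfK//.
  by rewrite -[0](rmorph0 (real_complex R)) (inj_eq (@complexI R)) cabs_eq0.
have cz : cabs z != 0 by rewrite cabs_eq0.
apply: (mulIf cz); rewrite mul1r -[X in _ * X](ger0_norm (cabs_ge0 z)).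
rewrite -cabs_real -cabsM divfK ?cabs_conj//.
by rewrite -[0](rmorph0 (real_complex R)) (inj_eq (@complexI R)).
Qed.

Definition rsummable {T} (g : T -> R) := psummable (fun x => `|g x|).

Lemma rsum_posneg T (g : T -> R) : rsummable g ->
  [/\ psummable (fun x => Num.max (g x) 0),
      psummable (fun x => Num.max (- g x) 0) &
      forall x, g x = Num.max (g x) 0 - Num.max (- g x) 0].
Proof.
move=> sg.
have h (a : R) : [/\ 0 <= Num.max a 0, Num.max a 0 <= `|a| & a = Num.max a 0 - Num.max (- a) 0].
  case: (boolP (a < 0)) => [a0|]; last rewrite -leNgt => a0.
    have na0 : 0 < - a by lra.
    rewrite (max_r (ltW a0)) (max_l (ltW na0)); split=> //; lra.
  have na0 : - a <= 0 by lra.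
  rewrite (max_l a0) (max_r na0) ger0_norm//; split=> //; lra.
split; last by move=> x; have [] := h (g x).
  by apply: le_psummable sg => x; have [] := h (g x).
by apply: le_psummable sg => x; have [] := h (- g x); rewrite ?normrN.
Qed.

Lemma rsumB T (g a b : T -> R) : psummable a -> psummable b ->
  (forall x, g x = a x - b x) ->
  rsummable g /\ rsum g = psum a - psum b.
Proof.
move=> pa pb gab.
have a0 x : 0 <= a x by case: pa.
have b0 x : 0 <= b x by case: pb.
have sg : rsummable g.
  apply: le_psummable (psumD pa pb).1 => // x; rewrite gab.
  by rewrite (le_trans (ler_normB _ _))// !ger0_norm.
split=> //; have [pp pn ge] := rsum_posneg sg.
rewrite /rsum; apply/eqP; rewrite subr_eq addrAC eq_sym subr_eq eq_sym; apply/eqP.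
rewrite -(psumD pp pb).2 -(psumD pa pn).2; apply: eq_psum => x.
by have := ge x; rewrite [X in X = _]gab; lra.
Qed.

Lemma rsumD T (g h : T -> R) : rsummable g -> rsummable h ->
  rsum (fun x => g x + h x) = rsum g + rsum h.
Proof.
move=> /rsum_posneg[gp gn ge] /rsum_posneg[hp hn he].
have [|_ ->] := @rsumB _ (fun x => g x + h x) _ _ (psumD gp hp).1 (psumD gn hn).1 _.
  by move=> x /=; have := ge x; have := he x; lra.
by rewrite (psumD gp hp).2 (psumD gn hn).2 /rsum; ring.
Qed.

Lemma rsumN T (g : T -> R) : rsum (fun x => - g x) = - rsum g.
Proof.
rewrite /rsum opprB; congr (_ - _); apply: eq_psum => x; by rewrite ?opprK.
Qed.

Lemma rsumZ T k (g : T -> R) : rsummable g ->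
  rsum (fun x => k * g x) = k * rsum g.
Proof.
wlog k0 : k / 0 <= k => [hw sg|].
  have [/hw->//|k0] := leP 0 k.
  rewrite -[k in RHS]opprK mulNr -hw//; last lra.
  by rewrite -rsumN; congr rsum; apply/funext => x; ring.
move=> /rsum_posneg[gp gn ge].
have [|_ ->] := @rsumB _ (fun x => k * g x) _ _ (psumZ k0 gp).1 (psumZ k0 gn).1 _.
  by move=> x /=; rewrite -mulrBr -ge.
by rewrite (psumZ k0 gp).2 (psumZ k0 gn).2 /rsum; ring.
Qed.

Lemma rsum_le T (g a : T -> R) : psummable a -> (forall x, `|g x| <= a x) ->
  rsum g <= psum a.
Proof.
move=> pa ga.
have sg : rsummable g by apply: le_psummable pa.
have [gp gn _] := rsum_posneg sg.
have h : psum (fun x => Num.max (g x) 0) <= psum a.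
  apply: le_psum pa => x; first by rewrite le_max lexx orbT.
  rewrite ge_max (le_trans (ler_norm _) (ga x))/=.
  exact: le_trans (ga x).
by rewrite /rsum; have := psum_ge0 gn; lra.
Qed.

Lemma rsum_exchange T T' (g : T -> T' -> R) :
  (forall x, rsummable (g x)) -> psummable (fun x => psum (fun y => `|g x y|)) ->
  rsum (fun x => rsum (g x)) = rsum (fun y => rsum (g^~ y)).
Proof.
move=> sg ssg.
have pos x := let: And3 p _ _ := rsum_posneg (sg x) in p.
have neg x := let: And3 _ p _ := rsum_posneg (sg x) in p.
have pospos x : 0 <= psum (fun y => Num.max (g x y) 0) by exact: psum_ge0.
have negpos x : 0 <= psum (fun y => Num.max (- g x y) 0) by exact: psum_ge0.
have le1 (a : R) : 0 <= Num.max a 0 <= `|a|.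
  by rewrite le_max lexx orbT ge_max ler_norm normr_ge0.
have ppos : psummable (fun x => psum (fun y => Num.max (g x y) 0)).
  apply: le_psummable ssg => // x.
  by apply: le_psum (sg x) => y; have /andP[] := le1 (g x y).
have pneg : psummable (fun x => psum (fun y => Num.max (- g x y) 0)).
  apply: le_psummable ssg => // x.
  by apply: le_psum (sg x) => y; have /andP[] := le1 (- g x y); rewrite ?normrN.
have [_ ->] := rsumB ppos pneg (fun x => erefl).
have [p1 p2 <-] := psum_exchange pos ppos.
have [n1 n2 <-] := psum_exchange neg pneg.
by have [_ ->] := rsumB p2 n2 (fun x => erefl).
Qed.

Lemma csummableP T (f : T -> C) : csummable f ->
  rsummable (fun x => Re (f x)) /\ rsummable (fun x => Im (f x)).
Proof.
by move=> sf; split; apply: le_psummable sf => x; rewrite ?Re_le ?Im_le.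
Qed.

Lemma csummableD T (f g : T -> C) : csummable f -> csummable g ->
  csummable (fun x => f x + g x).
Proof.
move=> sf sg; apply: le_psummable (psumD sf sg).1 => x; first exact: cabs_ge0.
exact: cabsD.
Qed.

Lemma csummableZ T c (f : T -> C) : csummable f -> csummable (fun x => c * f x).
Proof.
move=> sf; rewrite /csummable; under eq_fun do rewrite cabsM.
exact: (psumZ (cabs_ge0 c) sf).1.
Qed.

Lemma csumD T (f g : T -> C) : csummable f -> csummable g ->
  csum (fun x => f x + g x) = csum f + csum g.
Proof.
move=> /csummableP[rf imf] /csummableP[rg img].
rewrite /csum; under eq_fun do rewrite ReD.
by under [X in _ +i* rsum X]eq_fun do rewrite ImD; rewrite !rsumD.
Qed.

Lemma rsummableZ T k (g : T -> R) : rsummable g -> rsummable (fun x => k * g x).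
Proof.
move=> sg; rewrite /rsummable; under eq_fun do rewrite normrM.
by have [] := psumZ (normr_ge0 k) sg.
Qed.

Lemma csumZ T c (f : T -> C) : csummable f ->
  csum (fun x => c * f x) = c * csum f.
Proof.
move=> /csummableP[rf imf].
apply/eqP; rewrite eq_complex ReM ImM /=; apply/andP; split; apply/eqP.
  transitivity (rsum (fun x => Re c * Re (f x) + (- Im c) * Im (f x))).
    by congr rsum; apply/funext => x; rewrite ReM mulNr.
  by rewrite rsumD ?rsumZ ?mulNr//; exact: rsummableZ.
transitivity (rsum (fun x => Re c * Im (f x) + Im c * Re (f x))).
  by congr rsum; apply/funext => x; rewrite ImM.
by rewrite rsumD ?rsumZ//; exact: rsummableZ.
Qed.

Lemma cabs_csum_le T (f : T -> C) (a : T -> R) : psummable a ->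
  (forall x, cabs (f x) <= a x) -> cabs (csum f) <= psum a.
Proof.
move=> pa fa.
have sf : csummable f by apply: le_psummable pa => // x; exact: cabs_ge0.
have [u u1 ue] := cabs_phase (csum f).
have -> : cabs (csum f) = Re (csum (fun x => u * f x)) by rewrite csumZ// ue.
apply: rsum_le pa _ => x; apply: le_trans (Re_le _) _.
by rewrite cabsM u1 mul1r.
Qed.

Lemma cabs_csum T (f : T -> C) : csummable f ->
  cabs (csum f) <= psum (fun x => cabs (f x)).
Proof. by move=> sf; apply: cabs_csum_le. Qed.

Lemma csum_exchange T T' (f : T -> T' -> C) :
  (forall x, csummable (f x)) -> psummable (fun x => psum (fun y => cabs (f x y))) ->
  csum (fun x => csum (f x)) = csum (fun y => csum (f^~ y)).
Proof.
move=> sf ssf; rewrite /csum /=; congr (_ +i* _); apply: rsum_exchange => [x|].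
- by have [] := csummableP (sf x).
- apply: le_psummable ssf => x.
    by apply: psum_ge0; have [] := csummableP (sf x).
  by apply: le_psum (sf x) => y; rewrite ?Re_le.
- by have [] := csummableP (sf x).
- apply: le_psummable ssf => x.
    by apply: psum_ge0; have [] := csummableP (sf x).
  by apply: le_psum (sf x) => y; rewrite ?Im_le.
Qed.

Lemma csummable_reindex T T' (e : T -> T') (f : T' -> C) : bijective e ->
  csummable f -> csummable (f \o e).
Proof. by move=> be sf; have [] := psum_reindex be sf. Qed.

Lemma csum_reindex T T' (e : T -> T') (f : T' -> C) : bijective e ->
  csummable f -> csum (f \o e) = csum f.
Proof.
move=> be /csummableP[/rsum_posneg[a b _] /rsum_posneg[c d _]].
rewrite /csum /rsum; congr ((_ - _) +i* (_ - _)).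
- exact: (psum_reindex be a).2.
- exact: (psum_reindex be b).2.
- exact: (psum_reindex be c).2.
- exact: (psum_reindex be d).2.
Qed.

Lemma csum_conj T (f : T -> C) : csum (fun x => (f x)^*) = (csum f)^*.
Proof.
rewrite /csum /= -rsumN; congr Complex; congr rsum;
  by apply/funext => x; case: (f x).
Qed.

Lemma csum1 T (f : T -> C) x0 : (forall x, x != x0 -> f x = 0) ->
  csummable f /\ csum f = f x0.
Proof.
move=> f0.
have pm (z : R) : 0 <= Num.max z 0 by rewrite le_max lexx orbT.
split.
  have [] // := @psum1 _ _ (fun x => cabs (f x)) x0 (cabs_ge0 _).
  by move=> x /f0->; rewrite cabs0.
have h (k : C -> R) : k 0 = 0 -> rsum (fun x => k (f x)) = k (f x0).
  move=> k0.
  have [|_ e1] := @psum1 _ _ (fun x => Num.max (k (f x)) 0) x0 (pm _).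
    by move=> x /f0->; rewrite k0 max_r.
  have [|_ e2] := @psum1 _ _ (fun x => Num.max (- k (f x)) 0) x0 (pm _).
    by move=> x /f0->; rewrite k0 oppr0 max_r.
  rewrite /rsum e1 e2; case: (boolP (k (f x0) < 0)) => [a0|].
    by rewrite max_r ?ltW// max_l ?oppr_ge0 ?ltW//; ring.
  by rewrite -leNgt => a0; rewrite max_l// max_r ?oppr_le0// subr0.
by rewrite /csum (h Re)// (h Im)//; case: (f x0).
Qed.

End ComplexSums.

Section Multipliers.
Variables (R : realType) (G : zmodType).
Local Notation C := R[i].

Definition is_multiplier (w : G -> G -> C) : Prop :=
  [/\ forall x y, `|w x y| = 1,
      forall x y z, w x y * w (x + y) z = w x (y + z) * w y z,
      forall x, w x 0 = 1 &
      forall x, w 0 x = 1].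

Record multiplier := Multiplier {
  multiplier_fun :> G -> G -> C;
  multiplierP : is_multiplier multiplier_fun }.

(* The circle is the set of z : R[i] with `|z| = 1. *)
Definition cohomologous (w w' : multiplier) : Prop :=
  exists rho : G -> C, (forall s, `|rho s| = 1) /\
    forall s t, w s t = rho s * rho t * (rho (s + t))^* * w' s t.

End Multipliers.

Section TwistedConvolution.
Context {R : realType} {G : zmodType}.
Local Notation C := R[i].
Implicit Types (f g xi eta : G -> C) (x y : G).

Definition square_summable xi : Prop := psummable (fun x => cabs (xi x) ^+ 2).

Definition l2norm xi : R := Num.sqrt (psum (fun x => cabs (xi x) ^+ 2)).

Section Operations.
Variable w : multiplier R G.

(* The product and the involution of l^1(G). *)
Definition conv f g : G -> C :=
  fun x => csum (fun y => f y * g (x - y) * w y (x - y)).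

Definition conv_star f : G -> C := fun x => (w x (- x) * f (- x))^*.

(* L_w(x) on l^2(G), and its extension to l^1(G), that is the operator
   xi |-> sum_x f(x) L_w(x) xi; regular_norm is the operator norm of the
   latter. See regular_norm_has_sup: the supremum is over a nonempty bounded set. *)
Definition regular_rep x xi : G -> C := fun y => w x (y - x) * xi (y - x).

Definition regular_rep_l1 f xi : G -> C :=
  fun y => csum (fun x => f x * regular_rep x xi y).

Definition regular_norm f : R :=
  sup [set l2norm (regular_rep_l1 f xi) |
       xi in [set xi | square_summable xi /\ l2norm xi <= 1]].

End Operations.

Lemma bij_shift x : bijective (fun y : G => y - x).
Proof. by exists (fun y => y + x) => y; rewrite ?addrK ?subrK. Qed.

Lemma bij_shiftr x : bijective (fun y : G => x + y).
Proof. by exists (fun y => y - x) => y; rewrite addrC ?addKr ?subrK. Qed.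

Lemma bij_flip x : bijective (fun y : G => x - y).
Proof. by exists (fun y => x - y) => y; rewrite subKr. Qed.

Lemma bij_opp : bijective (fun y : G => - y).
Proof. by exists -%R => y; rewrite opprK. Qed.

Variable w : multiplier R G.

Lemma cabs_w x y : cabs (w x y) = 1.
Proof.
by have [h _ _ _] := multiplierP w; rewrite /cabs h.
Qed.

Lemma w0r x : w x 0 = 1. Proof. by have [] := multiplierP w. Qed.
Lemma w0l x : w 0 x = 1. Proof. by have [] := multiplierP w. Qed.
Lemma wA x y z : w x y * w (x + y) z = w x (y + z) * w y z.
Proof. by have [] := multiplierP w. Qed.

Lemma wJ x y : w x y * (w x y)^* = 1.
Proof. by rewrite mulcJ cabs_w expr1n. Qed.

Lemma w_neq0 x y : w x y != 0.
Proof. by rewrite -cabs_eq0 cabs_w oner_eq0. Qed.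

Lemma regular_rep_l1E f xi : regular_rep_l1 w f xi = conv w f xi.
Proof.
apply/funext => y; congr csum; apply/funext => x.
by rewrite /regular_rep -mulrA [w _ _ * _]mulrC.
Qed.

Definition ubounded xi := exists M, forall x, cabs (xi x) <= M.

Lemma bounded_term f g x : csummable f -> ubounded g ->
  csummable (fun y => f y * g (x - y) * w y (x - y)).
Proof.
move=> sf [M gM].
have M0 : 0 <= M by rewrite (le_trans (cabs_ge0 (g 0))).
apply: le_psummable (psumZ M0 sf).1 => y; first exact: cabs_ge0.
by rewrite !cabsM cabs_w mulr1 mulrC ler_wpM2r ?cabs_ge0.
Qed.

Lemma summable_bounded f : csummable f -> ubounded f.
Proof. by move=> sf; exists (psum (fun x => cabs (f x))) => x; exact: (psum_term x sf). Qed.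

Lemma l2norm_ge0 xi : 0 <= l2norm xi.
Proof. exact: sqrtr_ge0. Qed.

Lemma l2norm_sqr xi : square_summable xi ->
  l2norm xi ^+ 2 = psum (fun x => cabs (xi x) ^+ 2).
Proof. by move=> sx; rewrite sqr_sqrtr// psum_ge0. Qed.

Lemma l2norm_le xi K : 0 <= K -> square_summable xi ->
  psum (fun x => cabs (xi x) ^+ 2) <= K ^+ 2 -> l2norm xi <= K.
Proof.
move=> K0 sx; rewrite -l2norm_sqr// ler_pXn2r// ?nnegrE// l2norm_ge0//.
Qed.

Lemma cabs_le_l2norm xi x : square_summable xi -> cabs (xi x) <= l2norm xi.
Proof.
move=> sx; rewrite -(@ler_pXn2r _ 2)// ?nnegrE ?cabs_ge0 ?l2norm_ge0//.
by rewrite l2norm_sqr//; exact: (psum_term x sx).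
Qed.

Lemma l2_bounded xi : square_summable xi -> ubounded xi.
Proof. by move=> sx; exists (l2norm xi) => x; exact: cabs_le_l2norm. Qed.

Lemma l2Z c xi : square_summable xi ->
  square_summable (fun x => c * xi x) /\
  l2norm (fun x => c * xi x) = cabs c * l2norm xi.
Proof.
move=> sx; have [h1 h2] := psumZ (sqr_ge0 (cabs c)) sx.
have e : (fun x => cabs (c * xi x) ^+ 2) = (fun x => cabs c ^+ 2 * cabs (xi x) ^+ 2).
  by apply/funext => x; rewrite cabsM exprMn.
rewrite /square_summable /l2norm e; split=> //.
by rewrite h2 sqrtrM ?sqr_ge0// sqrtr_sqr ger0_norm ?cabs_ge0.
Qed.

Lemma l2_CS xi eta : square_summable xi -> square_summable eta ->
  psummable (fun x => cabs (xi x) * cabs (eta x)) /\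
  psum (fun x => cabs (xi x) * cabs (eta x)) <= l2norm xi * l2norm eta.
Proof.
move=> sx se; have [h1 h2] := psum_CS (fun x => cabs_ge0 (xi x))
  (fun x => cabs_ge0 (eta x)) sx se.
split=> //; rewrite -(@ler_pXn2r _ 2)// ?nnegrE ?psum_ge0//.
  by rewrite exprMn !l2norm_sqr.
by rewrite mulr_ge0 ?l2norm_ge0.
Qed.

Lemma l2D xi eta : square_summable xi -> square_summable eta ->
  square_summable (fun x => xi x + eta x) /\
  l2norm (fun x => xi x + eta x) <= l2norm xi + l2norm eta.
Proof.
move=> sx se; have [h1 h2] := l2_CS sx se.
have [h3 h4] := psumZ (ler0n R 2) h1.
have [h5 h6] := psumD sx se.
have [h7 h8] := psumD h5 h3.
have le x : cabs (xi x + eta x) ^+ 2 <=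
    cabs (xi x) ^+ 2 + cabs (eta x) ^+ 2 + 2 * (cabs (xi x) * cabs (eta x)).
  have := cabsD (xi x) (eta x); have := cabs_ge0 (xi x + eta x).
  have := cabs_ge0 (xi x); have := cabs_ge0 (eta x); nra.
have s : square_summable (fun x => xi x + eta x).
  by apply: le_psummable h7 => // x; rewrite sqr_ge0.
split=> //; apply: l2norm_le => //; first by rewrite addr_ge0 ?l2norm_ge0.
apply: le_trans (le_psum (fun x => sqr_ge0 _) le h7) _.
rewrite h8 h6 h4 sqrrD !l2norm_sqr//; lra.
Qed.

Lemma l2_shift xi x : square_summable xi ->
  psummable (fun y => cabs (xi (y - x)) ^+ 2) /\
  psum (fun y => cabs (xi (y - x)) ^+ 2) = psum (fun y => cabs (xi y) ^+ 2).
Proof. exact: (psum_reindex (bij_shift x)). Qed.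

(* Young's inequality *)
Lemma conv_l2 f xi : csummable f -> square_summable xi ->
  square_summable (conv w f xi) /\
  l2norm (conv w f xi) <= psum (fun x => cabs (f x)) * l2norm xi.
Proof.
move=> sf sx; set F := psum _; have F0 : 0 <= F by exact: psum_ge0.
pose a x y := cabs (f x) * cabs (xi (y - x)) ^+ 2.
have pa x : psummable (a x) /\ psum (a x) = cabs (f x) * l2norm xi ^+ 2.
  have [h1 h2] := l2_shift x sx.
  have [h3 h4] := psumZ (cabs_ge0 (f x)) h1.
  by split=> //; rewrite h4 h2 l2norm_sqr.
have [pp pe] : psummable (fun x => psum (a x)) /\
    psum (fun x => psum (a x)) = F * l2norm xi ^+ 2.
  under eq_fun do rewrite (pa _).2 mulrC.
  have [h1 h2] := psumZ (sqr_ge0 (l2norm xi)) sf.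
  by split=> //; rewrite h2 mulrC.
have [e1 e2 e3] := psum_exchange (fun x => (pa x).1) pp.
have le y : cabs (conv w f xi y) ^+ 2 <= F * psum (a^~ y).
  have sq (x : G) : Num.sqrt (cabs (f x)) ^+ 2 = cabs (f x).
    by rewrite sqr_sqrtr ?cabs_ge0.
  have p1 : psummable (fun x => Num.sqrt (cabs (f x)) ^+ 2).
    by under eq_fun do rewrite sq.
  have p2 : psummable (fun x => (Num.sqrt (cabs (f x)) * cabs (xi (y - x))) ^+ 2).
    by under eq_fun do rewrite exprMn sq; exact: e1.
  have [h1 h2] := psum_CS (fun x => sqrtr_ge0 (cabs (f x)))
    (fun x => mulr_ge0 (sqrtr_ge0 (cabs (f x))) (cabs_ge0 (xi (y - x)))) p1 p2.
  have -> : F = psum (fun x => Num.sqrt (cabs (f x)) ^+ 2).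
    by apply: eq_psum => x; rewrite sq.
  have -> : psum (a^~ y) =
      psum (fun x => (Num.sqrt (cabs (f x)) * cabs (xi (y - x))) ^+ 2).
    by apply: eq_psum => x; rewrite exprMn sq.
  apply: le_trans h2; rewrite ler_pXn2r ?nnegrE ?cabs_ge0 ?psum_ge0//.
  apply: cabs_csum_le h1 _ => x.
  by rewrite !cabsM cabs_w mulr1 mulrA -expr2 sq.
have [h1 h2] := psumZ F0 e2.
have sc : square_summable (conv w f xi).
  by apply: le_psummable h1 => // y; rewrite sqr_ge0.
split=> //; apply: l2norm_le => //; first by rewrite mulr_ge0 ?l2norm_ge0.
apply: le_trans (le_psum (fun y => sqr_ge0 _) le h1) _.
by rewrite h2 e3 pe exprMn mulrA -expr2.
Qed.

Lemma conv_l1 f g : csummable f -> csummable g -> csummable (conv w f g).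
Proof.
move=> sf sg.
pose a x y := cabs (f x) * cabs (g (y - x)).
have pa x : psummable (a x) /\ psum (a x) = cabs (f x) * psum (fun y => cabs (g y)).
  have [h1 h2] := psum_reindex (bij_shift x) sg.
  have [h3 h4] := psumZ (cabs_ge0 (f x)) h1.
  by split=> //; rewrite h4 h2.
have pp : psummable (fun x => psum (a x)).
  under eq_fun do rewrite (pa _).2 mulrC.
  by have [] := psumZ (psum_ge0 sg) sf.
have [e1 e2 _] := psum_exchange (fun x => (pa x).1) pp.
apply: le_psummable e2 => y; first exact: cabs_ge0.
apply: cabs_csum_le (e1 y) _ => x.
by rewrite !cabsM cabs_w mulr1.
Qed.

Lemma convDl f g xi : csummable f -> csummable g -> ubounded xi ->
  conv w (fun x => f x + g x) xi = (fun x => conv w f xi x + conv w g xi x).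
Proof.
move=> sf sg bx; apply/funext => x.
rewrite /conv -csumD; [|exact: bounded_term..].
by congr csum; apply/funext => y; rewrite !mulrDl.
Qed.

Lemma convZl c f xi : csummable f -> ubounded xi ->
  conv w (fun x => c * f x) xi = (fun x => c * conv w f xi x).
Proof.
move=> sf bx; apply/funext => x.
rewrite /conv -csumZ; last exact: bounded_term.
by congr csum; apply/funext => y; rewrite !mulrA.
Qed.

Lemma convDr f xi eta : csummable f -> ubounded xi -> ubounded eta ->
  conv w f (fun x => xi x + eta x) = (fun x => conv w f xi x + conv w f eta x).
Proof.
move=> sf bx be; apply/funext => x.
rewrite /conv -csumD; [|exact: bounded_term..].
by congr csum; apply/funext => y; rewrite mulrDr mulrDl.
Qed.

Lemma convZr c f xi : csummable f -> ubounded xi ->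
  conv w f (fun x => c * xi x) = (fun x => c * conv w f xi x).
Proof.
move=> sf bx; apply/funext => x.
rewrite /conv -csumZ; last exact: bounded_term.
by congr csum; apply/funext => y; rewrite mulrCA !mulrA.
Qed.

Lemma convA f g h : csummable f -> csummable g -> ubounded h ->
  conv w (conv w f g) h = conv w f (conv w g h).
Proof.
move=> sf sg [M hM]; apply/funext => z.
have M0 : 0 <= M by rewrite (le_trans (cabs_ge0 (h 0))).
have bg := summable_bounded sg.
pose k y x := f y * g (x - y) * w y (x - y) * h (z - x) * w x (z - x).
have kb y x : cabs (k y x) <= M * (cabs (f y) * cabs (g (x - y))).
  rewrite !cabsM !cabs_w !mulr1 mulrC ler_wpM2r ?mulr_ge0 ?cabs_ge0//.
pose a y x := M * (cabs (f y) * cabs (g (x - y))).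
have pa y : psummable (a y) /\ psum (a y) = M * (psum (fun y => cabs (g y)) * cabs (f y)).
  have [h1 h2] := psum_reindex (bij_shift y) sg.
  have [h3 h4] := psumZ (cabs_ge0 (f y)) h1.
  have [h5 h6] := psumZ M0 h3.
  by split=> //; rewrite h6 h4 h2 [cabs _ * _]mulrC.
have pp : psummable (fun y => psum (a y)).
  under eq_fun do rewrite (pa _).2.
  exact: (psumZ M0 (psumZ (psum_ge0 sg) sf).1).1.
have sk y : csummable (k y).
  by apply: le_psummable (pa y).1 => // x; exact: cabs_ge0.
have spk : psummable (fun y => psum (fun x => cabs (k y x))).
  apply: le_psummable pp => // y; first exact: psum_ge0 (sk y).
  by apply: le_psum (pa y).1 => // x; exact: cabs_ge0.
transitivity (csum (fun x => csum (k^~ x))).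
  congr csum; apply/funext => x.
  rewrite -mulrA mulrC /conv -csumZ; last exact: bounded_term.
  by congr csum; apply/funext => y; rewrite /k; ring.
rewrite -csum_exchange//; congr csum; apply/funext => y.
have eb : conv w g h (z - y) * w y (z - y) * f y =
    csum (fun x => (w y (z - y) * f y) * (g x * h (z - y - x) * w x (z - y - x))).
  rewrite csumZ; last by apply: bounded_term => //; exists M.
  by rewrite -mulrA mulrC -mulrA mulrC -mulrA; congr (_ * _); rewrite mulrC.
rewrite [RHS](_ : _ = conv w g h (z - y) * w y (z - y) * f y); last by ring.
rewrite eb -[RHS](csum_reindex (bij_shift y)); last first.
  by apply: csummableZ; apply: bounded_term => //; exists M.
congr csum; apply/funext => x /=; rewrite /k opprB addrA subrK.
have := wA y (x - y) (z - x); rewrite [y + (x - y)]addrC subrK.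
rewrite [x - y + (z - x)]addrC addrA subrK => e.
transitivity (f y * g (x - y) * h (z - x) * (w y (x - y) * w x (z - x))).
  by ring.
by rewrite e; ring.
Qed.

Lemma wNC x : w x (- x) = w (- x) x.
Proof. by have := wA x (- x) x; rewrite subrr addNr w0l w0r mulr1 mul1r. Qed.

Lemma conv_starK f : conv_star w (conv_star w f) = f.
Proof.
apply/funext => x; rewrite /conv_star opprK wNC rmorphM /= conjcK.
by rewrite mulrA [_^* * _]mulrC wJ mul1r.
Qed.

Lemma conv_star_l1 f : csummable f -> csummable (conv_star w f).
Proof.
move=> sf; rewrite /csummable.
under eq_fun do rewrite /conv_star cabs_conj cabsM cabs_w mul1r.
exact: (psum_reindex bij_opp sf).1.
Qed.

Lemma conv_starM f g : csummable f -> csummable g ->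
  conv_star w (conv w f g) = conv w (conv_star w g) (conv_star w f).
Proof.
move=> sf sg; apply/funext => x.
have bsf := summable_bounded (conv_star_l1 sf).
have bg := summable_bounded sg.
rewrite [RHS]/conv -(csum_reindex (bij_shiftr x)); last first.
  by apply: bounded_term => //; exact: conv_star_l1.
rewrite /conv_star /conv -csumZ; last exact: bounded_term.
rewrite -csum_conj; congr csum; apply/funext => y /=.
have -> : x - (x + y) = - y by rewrite opprD addrA subrr add0r.
rewrite -!rmorphM /= opprK opprD.
have wi u v : w u v = ((w u v)^*)^-1.
  by rewrite -[RHS]mul1r -(wJ u v) mulfK// conjc_eq0 w_neq0.
rewrite [w (x + y) (- y)]wi -conjc_inv -!rmorphM /=; congr (_^*).
have -> : w x (- x) * (f y * g (- x - y) * w y (- x - y)) =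
  f y * g (- x - y) * (w x (- x) * w y (- x - y)) by ring.
suff -> : w x (- x) * w y (- x - y) =
    w (x + y) (- x - y) * w (- y) y / w (x + y) (- y) by rewrite -?wNC; ring.
apply: (mulIf (w_neq0 (x + y) (- y))); rewrite divfK ?w_neq0//.
have e2 := wA x y (- x - y).
have yx : y + (- x - y) = - x by rewrite addrC subrK.
rewrite yx in e2.
have e3 := wA (x + y) (- y) y.
rewrite addrK addNr w0r mul1r in e3.
rewrite -e3.
transitivity (w x (- x) * w y (- x - y) * w (x + y) (- y)); first by ring.
by rewrite -e2; ring.
Qed.

Lemma conv_adjoint f xi eta : csummable f ->
  square_summable xi -> square_summable eta ->
  csum (fun y => conv w f xi y * (eta y)^*) =
  csum (fun y => xi y * (conv w (conv_star w f) eta y)^*).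
Proof.
move=> sf sx se.
pose k x y := f x * xi (y - x) * w x (y - x) * (eta y)^*.
have [bx be] := (l2_bounded sx, l2_bounded se).
have pk x : csummable (k x) /\ psum (fun y => cabs (k x y)) <=
    l2norm xi * l2norm eta * cabs (f x).
  have [h1 h2] := l2_shift x sx.
  have [h3 h4] := @l2_CS (fun y => xi (y - x)) _ h1 se.
  have [h5 h6] := psumZ (cabs_ge0 (f x)) h3.
  have e : (fun y => cabs (k x y)) =
      (fun y => cabs (f x) * (cabs (xi (y - x)) * cabs (eta y))).
    by apply/funext => y; rewrite !cabsM cabs_w mulr1 cabs_conj mulrA.
  rewrite /csummable e; split=> //; rewrite h6 mulrC ler_wpM2r ?cabs_ge0//.
  by rewrite (le_trans h4)// /l2norm h2.
have pp : psummable (fun x => psum (fun y => cabs (k x y))).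
  have l0 : 0 <= l2norm xi * l2norm eta by rewrite mulr_ge0 ?l2norm_ge0.
  apply: le_psummable (psumZ l0 sf).1 => x; last exact: (pk x).2.
  exact: psum_ge0 (pk x).1.
transitivity (csum (fun y => csum (k^~ y))).
  congr csum; apply/funext => y; rewrite mulrC /conv -csumZ; last exact: bounded_term.
  by congr csum; apply/funext => x; rewrite mulrC.
rewrite -csum_exchange => [|x|]; [|exact: (pk x).1|exact: pp].
pose k' x y := xi y * (conv_star w f x * eta (y - x) * w x (y - x))^*.
have key x y : k (- x) (y - x) = k' x y.
  rewrite /k /k' opprK subrK /conv_star !rmorphM /= !conjcK.
  have := wA x (- x) y; rewrite subrr w0l mulr1 [- x + y]addrC => e.
  rewrite e.
  have := wJ x (y - x) => e2.
  transitivity (w (-x) y * f (-x) * xi y * (eta (y - x))^* * 1); first by ring.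
  by rewrite -e2; ring.
transitivity (csum (fun x => csum (k' x))).
  have s1 : csummable (fun x => csum (k x)).
    apply: le_psummable pp => x; first exact: cabs_ge0.
    exact: cabs_csum (pk x).1.
  rewrite -(csum_reindex bij_opp s1); congr csum; apply/funext => x /=.
  rewrite -(csum_reindex (bij_shift x) (pk _).1); congr csum; apply/funext => y /=.
  exact: key.
have sk' x : csummable (k' x) /\ psum (fun y => cabs (k' x y)) = psum (fun y => cabs (k (- x) y)).
  have -> : k' x = k (- x) \o (fun y => y - x) by apply/funext => y; rewrite -key.
  exact: (psum_reindex (bij_shift x) (pk (- x)).1).
rewrite csum_exchange => [|x|]; [|exact: (sk' x).1|]; last first.
  under eq_fun do rewrite (sk' _).2.
  exact: (psum_reindex bij_opp pp).1.
congr csum; apply/funext => y.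
rewrite /conv -csum_conj -csumZ//.
have s2 : csummable (fun x => conv_star w f x * eta (y - x) * w x (y - x)).
  by apply: bounded_term => //; exact: conv_star_l1.
by rewrite /csummable; under eq_fun do rewrite cabs_conj.
Qed.

End TwistedConvolution.

Section RegularNorm.
Context {R : realType} {G : zmodType}.
Local Notation C := R[i].
Implicit Types (f g xi eta : G -> C) (x y : G).
Variable w : multiplier R G.

Lemma l2_0 : square_summable (fun _ : G => 0 : C) /\ l2norm (fun _ : G => 0 : C) = 0.
Proof.
have [|h1 h2] := @psum0 R G (fun x => cabs (0 : C) ^+ 2).
  by move=> x; rewrite cabs0 expr0n.
by split=> //; rewrite /l2norm h2 sqrtr0.
Qed.

Lemma regular_norm_has_sup f : csummable f ->
  has_sup [set l2norm (regular_rep_l1 w f xi) |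
       xi in [set xi | square_summable xi /\ l2norm xi <= 1]].
Proof.
move=> sf; split.
  exists (l2norm (regular_rep_l1 w f (fun _ => 0))), (fun _ => 0) => //=.
  by have [? ->] := l2_0.
exists (psum (fun x => cabs (f x))) => _ [xi [sx x1] <-].
rewrite regular_rep_l1E (le_trans (conv_l2 w sf sx).2)//.
by rewrite ler_piMr// psum_ge0.
Qed.

Lemma regular_norm_le f K : csummable f -> 0 <= K ->
  (forall xi, square_summable xi -> l2norm (conv w f xi) <= K * l2norm xi) ->
  regular_norm w f <= K.
Proof.
move=> sf K0 h; apply: sup_le_ub; first by have [] := regular_norm_has_sup sf.
move=> _ [xi [sx x1] <-]; rewrite regular_rep_l1E (le_trans (h _ sx))//.
by rewrite ler_piMr.
Qed.

Lemma regular_norm_ge0 f : csummable f -> 0 <= regular_norm w f.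
Proof.
move=> sf; have [[r rE] hb] := regular_norm_has_sup sf.
have r0 : 0 <= r by case: rE => xi _ <-; exact: l2norm_ge0.
by rewrite (le_trans r0)//; apply: ub_le_sup.
Qed.

Lemma conv_le f xi : csummable f -> square_summable xi ->
  l2norm (conv w f xi) <= regular_norm w f * l2norm xi.
Proof.
move=> sf sx; have [z|nz] := eqVneq (l2norm xi) 0.
  by have [_] := conv_l2 w sf sx; rewrite z !mulr0.
have np : 0 < l2norm xi by rewrite lt_neqAle eq_sym nz l2norm_ge0.
have [se e1] := l2Z (l2norm xi)^-1%:C sx.
rewrite cabs_real ger0_norm ?invr_ge0 ?l2norm_ge0// mulVf// in e1.
rewrite -ler_pdivrMr// mulrC.
have h : l2norm (conv w f (fun x => (l2norm xi)^-1%:C * xi x)) <= regular_norm w f.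
  rewrite -regular_rep_l1E; apply: ub_le_sup.
    by have [] := regular_norm_has_sup sf.
  by exists (fun x => (l2norm xi)^-1%:C * xi x) => //; split=> //; rewrite e1.
apply: le_trans h; rewrite convZr//; last exact: l2_bounded.
rewrite (l2Z _ (conv_l2 w sf sx).1).2 cabs_real ger0_norm//.
by rewrite invr_ge0 l2norm_ge0.
Qed.

Opaque conv conv_star regular_norm l2norm.

Lemma regular_normD f g : csummable f -> csummable g ->
  regular_norm w (fun x => f x + g x) <= regular_norm w f + regular_norm w g.
Proof.
move=> sf sg; apply: regular_norm_le => [||xi sx].
- exact: csummableD.
- by rewrite addr_ge0 ?regular_norm_ge0.
rewrite convDl//; last exact: l2_bounded.
rewrite (le_trans (l2D (conv_l2 w sf sx).1 (conv_l2 w sg sx).1).2)// mulrDl.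
by rewrite lerD// conv_le.
Qed.

Lemma regular_normZ_le c f : csummable f ->
  regular_norm w (fun x => c * f x) <= cabs c * regular_norm w f.
Proof.
move=> sf; apply: regular_norm_le => [||xi sx].
- exact: csummableZ.
- by rewrite mulr_ge0 ?cabs_ge0 ?regular_norm_ge0.
rewrite convZl//; last exact: l2_bounded.
rewrite (l2Z _ (conv_l2 w sf sx).1).2 -mulrA.
by rewrite ler_wpM2l ?cabs_ge0// conv_le.
Qed.

Lemma regular_normZ c f : csummable f ->
  regular_norm w (fun x => c * f x) = cabs c * regular_norm w f.
Proof.
move=> sf; apply/eqP; rewrite eq_le regular_normZ_le//=.
have [->|c0] := eqVneq c 0.
  rewrite cabs0 mul0r; apply: regular_norm_ge0; exact: csummableZ.
have cp : 0 < cabs c by rewrite lt_neqAle eq_sym cabs_eq0 c0 cabs_ge0.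
rewrite -ler_pdivlMl//.
have /(regular_normZ_le c^-1) := csummableZ c sf.
under [X in regular_norm w X]eq_fun do rewrite mulKf//.
suff -> : cabs c^-1 = (cabs c)^-1 by [].
apply: (mulfI (lt0r_neq0 cp)); rewrite -cabsM (divff c0) divff ?lt0r_neq0//.
by rewrite /cabs normr1.
Qed.

Lemma regular_normM f g : csummable f -> csummable g ->
  regular_norm w (conv w f g) <= regular_norm w f * regular_norm w g.
Proof.
move=> sf sg; apply: regular_norm_le => [||xi sx].
- exact: conv_l1.
- by rewrite mulr_ge0 ?regular_norm_ge0.
rewrite convA//; last exact: l2_bounded.
rewrite (le_trans (conv_le sf (conv_l2 w sg sx).1))// -mulrA.
by rewrite ler_wpM2l ?regular_norm_ge0// conv_le.
Qed.

Lemma csum_CS xi eta : square_summable xi -> square_summable eta ->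
  cabs (csum (fun y => xi y * (eta y)^*)) <= l2norm xi * l2norm eta.
Proof.
move=> sx se; have [h1 h2] := l2_CS sx se; apply: le_trans h2.
by apply: cabs_csum_le h1 _ => x; rewrite cabsM cabs_conj.
Qed.

Lemma csum_sqr xi : square_summable xi ->
  cabs (csum (fun y => xi y * (xi y)^*)) = l2norm xi ^+ 2.
Proof.
move=> sx; rewrite l2norm_sqr// -[RHS]ger0_norm ?psum_ge0// -cabs_real.
congr cabs.
have p0 := @psum0 R G (fun=> 0) (fun=> erefl).
rewrite /csum; apply/eqP; rewrite eq_complex /=; apply/andP; split; apply/eqP.
  have [|_] := @rsumB R G (fun x => complex.Re (xi x * (xi x)^*)) _ _ sx p0.1.
    by move=> x; rewrite mulcJ subr0.
  by rewrite p0.2 subr0.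
have [|_] := @rsumB R G (fun x => complex.Im (xi x * (xi x)^*)) _ _ p0.1 p0.1.
  by move=> x; rewrite mulcJ subr0.
by rewrite p0.2 subr0.
Qed.

Lemma regular_norm_star_le f : csummable f ->
  regular_norm w (conv_star w f) <= regular_norm w f.
Proof.
move=> sf; have ssf := conv_star_l1 w sf.
apply: regular_norm_le => [//||xi sx]; first exact: regular_norm_ge0.
have sc := (conv_l2 w ssf sx).1.
set n := l2norm _; have [->|nz] := eqVneq n 0.
  by rewrite mulr_ge0 ?regular_norm_ge0 ?l2norm_ge0.
have np : 0 < n by rewrite lt_neqAle eq_sym nz l2norm_ge0.
rewrite -(ler_pM2r np) -expr2 -csum_sqr// conv_adjoint// conv_starK.
apply: le_trans (csum_CS sx (conv_l2 w sf sc).1) _.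
rewrite mulrAC mulrC ler_wpM2r ?l2norm_ge0//; exact: conv_le.
Qed.

Lemma regular_norm_star f : csummable f ->
  regular_norm w (conv_star w f) = regular_norm w f.
Proof.
move=> sf; apply: le_anti; apply/andP; split; first exact: regular_norm_star_le.
by have := regular_norm_star_le (conv_star_l1 w sf); rewrite conv_starK.
Qed.

Lemma regular_norm_cstar f : csummable f ->
  regular_norm w (conv w (conv_star w f) f) = regular_norm w f ^+ 2.
Proof.
move=> sf; have ssf := conv_star_l1 w sf; have scf := conv_l1 w ssf sf.
apply/eqP; rewrite eq_le; apply/andP; split.
  by apply: le_trans (regular_normM ssf sf) _; rewrite (regular_norm_star sf) expr2.
have n0 := regular_norm_ge0 scf; have f0 := regular_norm_ge0 sf.
suff h : regular_norm w f <= Num.sqrt (regular_norm w (conv w (conv_star w f) f)).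
  by rewrite -[leRHS](sqr_sqrtr n0); apply: lerXn2r h; rewrite nnegrE ?sqrtr_ge0.
have s0 := sqrtr_ge0 (regular_norm w (conv w (conv_star w f) f)).
apply: (regular_norm_le sf s0) => xi sx.
have sc := (conv_l2 w sf sx).1.
have x0 := l2norm_ge0 xi; have c0 := l2norm_ge0 (conv w f xi).
rewrite -(@ler_pXn2r _ 2)// ?nnegrE ?(mulr_ge0 s0 x0)//.
rewrite [leRHS]exprMn [X in _ <= X * _](sqr_sqrtr n0) -csum_sqr// conv_adjoint//.
rewrite -convA//; last exact: l2_bounded.
apply: le_trans (csum_CS sx (conv_l2 w scf sx).1) _.
apply: le_trans (ler_wpM2l x0 (conv_le scf sx)) _.
by rewrite expr2 mulrCA.
Qed.

Transparent conv conv_star regular_norm l2norm.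

End RegularNorm.

Section CstarAlgebras.
Variable R : realType.

(* A complex *-algebra with a C*-seminorm; the *-algebra is not required to be
   unital, nor complete. *)
Record preCstarAlgebra := PreCstarAlgebra {
  cs_sort :> lmodType R[i];
  cs_mul : cs_sort -> cs_sort -> cs_sort;
  cs_star : cs_sort -> cs_sort;
  cs_norm : cs_sort -> R;
  cs_mulA : associative cs_mul;
  cs_mulDl : left_distributive cs_mul +%R;
  cs_mulDr : right_distributive cs_mul +%R;
  cs_mulZl : forall c a b, cs_mul (c *: a) b = c *: cs_mul a b;
  cs_mulZr : forall c a b, cs_mul a (c *: b) = c *: cs_mul a b;
  cs_starK : involutive cs_star;
  cs_starD : {morph cs_star : a b / a + b};
  cs_starZ : forall c a, cs_star (c *: a) = c^* *: cs_star a;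
  cs_starM : forall a b, cs_star (cs_mul a b) = cs_mul (cs_star b) (cs_star a);
  cs_normD : forall a b, cs_norm (a + b) <= cs_norm a + cs_norm b;
  cs_normZ : forall c a, cs_norm (c *: a) = cabs c * cs_norm a;
  cs_normM : forall a b, cs_norm (cs_mul a b) <= cs_norm a * cs_norm b;
  cs_norm_cstar : forall a, cs_norm (cs_mul (cs_star a) a) = cs_norm a ^+ 2 }.

Definition cs_cauchy (A : preCstarAlgebra) (u : nat -> A) : Prop :=
  forall e : R, 0 < e -> exists N, forall m n, (N <= m)%N -> (N <= n)%N ->
    cs_norm (u m - u n) < e.

Definition cs_cvg (A : preCstarAlgebra) (u : nat -> A) (a : A) : Prop :=
  forall e : R, 0 < e -> exists N, forall n, (N <= n)%N -> cs_norm (u n - a) < e.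

Record cstarAlgebra := CstarAlgebra {
  cs_base :> preCstarAlgebra;
  cs_norm_eq0 : forall a : cs_base, cs_norm a = 0 -> a = 0;
  cs_complete : forall u : nat -> cs_base, cs_cauchy u -> exists a, cs_cvg u a }.

(* A bijective *-homomorphism of C*-algebras is automatically isometric. *)
Definition star_isomorphic (A B : cstarAlgebra) : Prop :=
  exists phi : A -> B,
    [/\ bijective phi, linear phi,
        {morph phi : a b / cs_mul a b} &
        {morph phi : a / cs_star a}].

End CstarAlgebras.

Section L1.
Variables (R : realType) (G : zmodType).

Definition l1_pred : {pred G -> R[i]} := [pred f | `[< csummable f >]].

Lemma l1_submod_closed : submod_closed l1_pred.
Proof.
split=> [|c f g /asboolP sf /asboolP sg]; apply/asboolP.
  by apply: (psum0 _).1 => x; rewrite cabs0.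
exact: csummableD (csummableZ c sf) sg.
Qed.

HB.instance Definition _ :=
  GRing.isSubmodClosed.Build R[i] (G -> R[i]) l1_pred l1_submod_closed.

Record l1 := L1 { l1_fun :> G -> R[i]; l1_funP : l1_fun \in l1_pred }.
HB.instance Definition _ := [isSub for l1_fun].
HB.instance Definition _ := [Choice of l1 by <:].
HB.instance Definition _ := [SubChoice_isSubLmodule of l1 by <:].

Lemma l1P (f : l1) : csummable f.
Proof. exact/asboolP/l1_funP. Qed.

Definition mk_l1 f (sf : csummable f) : l1 := L1 (asboolT sf).

Variable w : multiplier R G.
Definition l1_conv (f g : l1) : l1 := mk_l1 (conv_l1 w (l1P f) (l1P g)).
Definition l1_star (f : l1) : l1 := mk_l1 (conv_star_l1 w (l1P f)).

Lemma l1_eq (f g : l1) : l1_fun f = l1_fun g -> f = g.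
Proof. exact: val_inj. Qed.

Definition l1_norm (f : l1) : R := regular_norm w f.

Lemma l1_ubounded (f : l1) : ubounded f.
Proof. exact/summable_bounded/l1P. Qed.

Lemma l1_convA : associative l1_conv.
Proof.
move=> f g h; apply: l1_eq => /=.
by rewrite (convA w (l1P f) (l1P g) (l1_ubounded h)).
Qed.

Lemma l1_convDl : left_distributive l1_conv +%R.
Proof.
by move=> f g h; apply: l1_eq; exact: (convDl w (l1P f) (l1P g) (l1_ubounded h)).
Qed.

Lemma l1_convDr : right_distributive l1_conv +%R.
Proof.
move=> f g h; apply: l1_eq.
exact: (convDr w (l1P f) (l1_ubounded g) (l1_ubounded h)).
Qed.

Lemma l1_convZl c f g : l1_conv (c *: f) g = c *: l1_conv f g.
Proof. by apply: l1_eq; exact: (convZl w c (l1P f) (l1_ubounded g)). Qed.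

Lemma l1_convZr c f g : l1_conv f (c *: g) = c *: l1_conv f g.
Proof. by apply: l1_eq; exact: (convZr w c (l1P f) (l1_ubounded g)). Qed.

Lemma l1_starK : involutive l1_star.
Proof. by move=> f; apply: l1_eq; exact: conv_starK. Qed.

Lemma l1_starD : {morph l1_star : f g / f + g}.
Proof.
move=> f g; apply: l1_eq; apply/funext => x.
exact: etrans (congr1 (@conjc R) (mulrDr _ _ _)) (rmorphD _ _ _).
Qed.

Lemma l1_starZ c f : l1_star (c *: f) = c^* *: l1_star f.
Proof.
apply: l1_eq; apply/funext => x.
exact: etrans (congr1 (@conjc R) (mulrCA _ _ _)) (rmorphM _ _ _).
Qed.

Lemma l1_starM f g : l1_star (l1_conv f g) = l1_conv (l1_star g) (l1_star f).
Proof. by apply: l1_eq; exact: (conv_starM w (l1P f) (l1P g)). Qed.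

Lemma l1_normD f g : l1_norm (f + g) <= l1_norm f + l1_norm g.
Proof. exact: (regular_normD w (l1P f) (l1P g)). Qed.

Lemma l1_normZ c f : l1_norm (c *: f) = cabs c * l1_norm f.
Proof. exact: (regular_normZ w c (l1P f)). Qed.

Lemma l1_normM f g : l1_norm (l1_conv f g) <= l1_norm f * l1_norm g.
Proof. exact: (regular_normM w (l1P f) (l1P g)). Qed.

Lemma l1_norm_cstar f : l1_norm (l1_conv (l1_star f) f) = l1_norm f ^+ 2.
Proof. exact: (regular_norm_cstar w (l1P f)). Qed.

Definition l1_algebra : preCstarAlgebra R :=
  PreCstarAlgebra l1_convA l1_convDl l1_convDr l1_convZl l1_convZr l1_starK
    l1_starD l1_starZ l1_starM l1_normD l1_normZ l1_normM l1_norm_cstar.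

End L1.

Section PreCstarTheory.
Local Open Scope quotient_scope.
Variables (R : realType) (A : preCstarAlgebra R).
Implicit Types (a b : A) (u v : nat -> A).
Local Notation N := (@cs_norm R A).

Lemma cs_norm0 : N 0 = 0.
Proof. by rewrite -(scale0r 0) cs_normZ cabs0 mul0r. Qed.

Lemma cs_normN a : N (- a) = N a.
Proof. by rewrite -scaleN1r cs_normZ cabsN /cabs normr1 mul1r. Qed.

Lemma cs_norm_ge0 a : 0 <= N a.
Proof. by have := cs_normD a (- a); rewrite subrr cs_norm0 cs_normN; lra. Qed.

Lemma cs_norm_dist a b : `|N a - N b| <= N (a - b).
Proof.
have h1 := cs_normD (a - b) b; have h2 := cs_normD (b - a) a.
rewrite !subrK -(opprB a b) cs_normN in h1 h2.
by rewrite ler_norml; lra.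
Qed.

Lemma cs_norm_tri a b c : N (a - c) <= N (a - b) + N (b - c).
Proof. by rewrite -(subrKA b a) cs_normD. Qed.

Lemma cs_norm_star a : N (cs_star a) = N a.
Proof.
have h b : N b <= N (cs_star b).
  have := cs_norm_cstar b; have := cs_normM (cs_star b) b.
  have := cs_norm_ge0 b; have := cs_norm_ge0 (cs_star b); nra.
by apply: le_anti; rewrite h andbT (le_trans (h _))// cs_starK.
Qed.

Lemma cs_starB a b : cs_star (a - b) = cs_star a - cs_star b.
Proof. by rewrite cs_starD -(scaleN1r b) cs_starZ rmorphN1 scaleN1r. Qed.

Lemma cs_mulNl a b : cs_mul (- a) b = - cs_mul a b.
Proof. by rewrite -(scaleN1r a) cs_mulZl scaleN1r. Qed.

Lemma cs_mulNr a b : cs_mul a (- b) = - cs_mul a b.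
Proof. by rewrite -(scaleN1r b) cs_mulZr scaleN1r. Qed.

Lemma cs_mulBB a b c d :
  cs_mul a b - cs_mul c d = cs_mul (a - c) b + cs_mul c (b - d).
Proof.
rewrite cs_mulDl cs_mulDr cs_mulNl cs_mulNr.
by rewrite addrA subrK.
Qed.

Lemma cs_cauchy_bounded u : cs_cauchy u -> exists2 M, 0 < M & \forall n \near \oo, N (u n) <= M.
Proof.
move=> /(_ 1 ltr01)[K hK]; exists (N (u K) + 1).
  by rewrite ltr_wpDl ?cs_norm_ge0.
exists K => // n /= Kn; have := hK n K Kn (leqnn K).
by have := cs_normD (u n - u K) (u K); rewrite subrK; lra.
Qed.

Lemma cs_cauchy_norm u : cs_cauchy u -> cvgn (fun n => N (u n)).
Proof.
move=> cu; apply: cauchy_cvg; apply: cauchy_exP => e e0.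
have [K hK] := cu e e0; exists (N (u K)); exists K => // n /= Kn.
exact: le_lt_trans (cs_norm_dist _ _) (hK _ _ (leqnn K) Kn).
Qed.

Definition cs_null u : Prop := forall e : R, 0 < e ->
  exists K, forall n, (K <= n)%N -> N (u n) < e.

Lemma cs_nullP u : cs_null u <-> (fun n => N (u n)) @ \oo --> (0 : R).
Proof.
split=> [h|h e e0].
  apply/cvgrPdist_lt => e e0; have [K hK] := h e e0; exists K => // n /= Kn.
  by rewrite sub0r normrN ger0_norm ?cs_norm_ge0// hK.
move/cvgrPdist_lt: h => /(_ e e0)[K _ hK]; exists K => n Kn.
by have := hK n Kn; rewrite sub0r normrN ger0_norm ?cs_norm_ge0.
Qed.

Lemma cs_cauchyE u v w : cs_cauchy u -> cs_cauchy v ->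
  (exists M, 0 < M /\ exists K, forall m n, (K <= m)%N -> (K <= n)%N ->
     N (w m - w n) <= M * (N (u m - u n) + N (v m - v n))) -> cs_cauchy w.
Proof.
move=> cu cv [M [M0 [K hK]]] e e0.
have e2 : 0 < e / M / 2 by rewrite !divr_gt0.
have [K1 h1] := cu _ e2; have [K2 h2] := cv _ e2.
exists (maxn K (maxn K1 K2)) => m n; rewrite !geq_max.
move=> /andP[Km /andP[K1m K2m]] /andP[Kn /andP[K1n K2n]].
apply: le_lt_trans (hK _ _ Km Kn) _.
rewrite -ltr_pdivlMl// mulrC [ltRHS]splitr.
by rewrite ltrD ?h1 ?h2.
Qed.

Lemma cs_cauchyD u v : cs_cauchy u -> cs_cauchy v -> cs_cauchy (fun n => u n + v n).
Proof.
move=> cu cv; apply: (cs_cauchyE cu cv); exists 1; split=> //; exists 0%N => m n _ _.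
by rewrite mul1r opprD addrACA cs_normD.
Qed.

Lemma cs_cauchyZ c u : cs_cauchy u -> cs_cauchy (fun n => c *: u n).
Proof.
move=> cu; apply: (cs_cauchyE cu cu); exists (cabs c + 1); split.
  by rewrite ltr_wpDl ?cabs_ge0.
exists 0%N => m n _ _; rewrite -scalerBr cs_normZ.
have := cabs_ge0 c; have := cs_norm_ge0 (u m - u n); nra.
Qed.

Lemma cs_cauchy0 : cs_cauchy (fun _ => 0 : A).
Proof. by move=> e e0; exists 0%N => m n _ _; rewrite subrr cs_norm0. Qed.

Lemma cs_cauchyM u v : cs_cauchy u -> cs_cauchy v ->
  cs_cauchy (fun n => cs_mul (u n) (v n)).
Proof.
move=> cu cv; have [M1 M10 [K1 _ h1]] := cs_cauchy_bounded cu.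
have [M2 M20 [K2 _ h2]] := cs_cauchy_bounded cv.
apply: (cs_cauchyE cu cv); exists (M1 + M2); split; first by rewrite addr_gt0.
exists (maxn K1 K2) => m n; rewrite !geq_max => /andP[K1m K2m] /andP[K1n K2n].
rewrite cs_mulBB; apply: le_trans (cs_normD _ _) _.
have := cs_normM (u m - u n) (v m); have := cs_normM (u n) (v m - v n).
have := h2 _ K2m; have := h1 _ K1n => /=.
have := cs_norm_ge0 (u m - u n); have := cs_norm_ge0 (v m - v n).
have := cs_norm_ge0 (u n); have := cs_norm_ge0 (v m); nra.
Qed.

Lemma cs_cauchy_star u : cs_cauchy u -> cs_cauchy (fun n => cs_star (u n)).
Proof.
by move=> cu e /cu[K hK]; exists K => m n Km Kn; rewrite -cs_starB cs_norm_star hK.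
Qed.

Definition cseq_pred : {pred nat -> A} := [pred u | `[< cs_cauchy u >]].

Lemma cseq_submod_closed : submod_closed cseq_pred.
Proof.
split=> [|c u v /asboolP cu /asboolP cv]; apply/asboolP; first exact: cs_cauchy0.
exact: cs_cauchyD (cs_cauchyZ c cu) cv.
Qed.

HB.instance Definition _ :=
  GRing.isSubmodClosed.Build R[i] (nat -> A) cseq_pred cseq_submod_closed.

Record cseq := Cseq { cseq_fun :> nat -> A; cseq_funP : cseq_fun \in cseq_pred }.
HB.instance Definition _ := [isSub for cseq_fun].
HB.instance Definition _ := [Choice of cseq by <:].
HB.instance Definition _ := [SubChoice_isSubLmodule of cseq by <:].

Lemma cseqP (u : cseq) : cs_cauchy u.
Proof. exact/asboolP/cseq_funP. Qed.

Definition mk_cseq (u : nat -> A) (cu : cs_cauchy u) : cseq := Cseq (asboolT cu).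

Definition null_pred : {pred cseq} := [pred u | `[< cs_null (cseq_fun u) >]].

Lemma null_zmod_closed : zmod_closed null_pred.
Proof.
split=> [|u v /asboolP nu /asboolP nv]; apply/asboolP.
  by move=> e e0; exists 0%N => n _; rewrite cs_norm0.
move=> e e0; have e2 : 0 < e / 2 by rewrite divr_gt0.
have [K1 h1] := nu _ e2; have [K2 h2] := nv _ e2.
exists (maxn K1 K2) => n; rewrite geq_max => /andP[/h1 {}h1 /h2 {}h2].
have := cs_normD (u n) (- v n); rewrite cs_normN.
have -> : cseq_fun (u - v) n = u n - v n by [].
lra.
Qed.

HB.instance Definition _ :=
  GRing.isZmodClosed.Build cseq null_pred null_zmod_closed.

(* The completion: Cauchy sequences modulo null sequences. The operations are
   computed on representatives; see piM, pi_star and cnorm_pi. *)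
Definition completion_type := Quotient.quot null_pred.
HB.instance Definition _ := GRing.Zmodule.on completion_type.
HB.instance Definition _ := EqQuotient.on completion_type.

Local Notation Q := completion_type.
Implicit Types (p q r : Q) (s t : cseq).

Definition cscale (c : R[i]) p : Q :=
  \pi_Q (mk_cseq (cs_cauchyZ c (cseqP (repr p)))).
Definition cmul p q : Q :=
  \pi_Q (mk_cseq (cs_cauchyM (cseqP (repr p)) (cseqP (repr q)))).
Definition cstar p : Q := \pi_Q (mk_cseq (cs_cauchy_star (cseqP (repr p)))).
Definition cnorm p : R := limn (fun n => N (repr p n)).

Lemma pi_eq s t : cs_null (fun n => s n - t n) <-> \pi_Q s = \pi_Q t.
Proof.
split=> [h|/eqP].
  apply/eqP; rewrite -Quotient.idealrBE; exact/asboolP.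
by rewrite -Quotient.idealrBE => /asboolP.
Qed.

Lemma repr_null s : cs_null (fun n => s n - repr (\pi_Q s) n).
Proof. by apply/pi_eq; rewrite reprK. Qed.


Lemma cpiP p : exists s, p = \pi_Q s.
Proof. by exists (repr p); rewrite reprK. Qed.

Lemma piD s t : \pi_Q (s + t) = \pi_Q s + \pi_Q t.
Proof. exact: (raddfD (\pi_(Quotient.quot null_pred))). Qed.

Lemma piB s t : \pi_Q (s - t) = \pi_Q s - \pi_Q t.
Proof. exact: (raddfB (\pi_(Quotient.quot null_pred))). Qed.

Lemma cs_null_le u v M :
  cs_null u -> (\forall n \near \oo, N (v n) <= M * N (u n)) -> cs_null v.
Proof.
move=> nu [K1 _ h1] e e0.
have M1 : 0 < `|M| + 1 by rewrite ltr_wpDl.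
have [K2 h2] := nu (e / (`|M| + 1)) (divr_gt0 e0 M1).
exists (maxn K1 K2) => n; rewrite geq_max => /andP[/h1 /= {}h1 /h2 {}h2].
apply: le_lt_trans h1 _; move: h2; rewrite ltr_pdivlMr//; apply: le_lt_trans.
by rewrite mulrC ler_wpM2l ?cs_norm_ge0//; have := ler_norm M; lra.
Qed.

Lemma cs_nullD u v : cs_null u -> cs_null v -> cs_null (fun n => u n + v n).
Proof.
move=> nu nv e e0; have e2 : 0 < e / 2 by rewrite divr_gt0.
have [K1 h1] := nu _ e2; have [K2 h2] := nv _ e2.
exists (maxn K1 K2) => n; rewrite geq_max => /andP[/h1 {}h1 /h2 {}h2].
by have := cs_normD (u n) (v n); lra.
Qed.

Lemma piZ c s : cscale c (\pi_Q s) = \pi_Q (mk_cseq (cs_cauchyZ c (cseqP s))).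
Proof.
apply/esym/pi_eq; apply: (@cs_null_le _ _ (cabs c) (repr_null s)).
by near=> n => /=; rewrite -scalerBr cs_normZ.
Unshelve. all: by end_near. Qed.

Lemma piM s t :
  cmul (\pi_Q s) (\pi_Q t) = \pi_Q (mk_cseq (cs_cauchyM (cseqP s) (cseqP t))).
Proof.
apply/esym/pi_eq; set s' := repr _; set t' := repr _.
have [M1 M10 b1] := cs_cauchy_bounded (cseqP t).
have [M2 M20 b2] := cs_cauchy_bounded (cseqP s').
rewrite (_ : (fun n => _) = (fun n => cs_mul (s n - s' n) (t n) + cs_mul (s' n) (t n - t' n))).
  apply: cs_nullD.
    apply: (@cs_null_le _ _ M1 (repr_null s)); near=> n.
    apply: le_trans (cs_normM _ _) _; rewrite mulrC ler_wpM2r ?cs_norm_ge0//.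
    by near: n.
  apply: (@cs_null_le _ _ M2 (repr_null t)); near=> n.
  apply: le_trans (cs_normM _ _) _; rewrite ler_wpM2r ?cs_norm_ge0//.
  by near: n.
by apply/funext => n; rewrite -cs_mulBB.
Unshelve. all: by end_near. Qed.

Lemma pi_star s : cstar (\pi_Q s) = \pi_Q (mk_cseq (cs_cauchy_star (cseqP s))).
Proof.
apply/esym/pi_eq; apply: (@cs_null_le _ _ 1 (repr_null s)).
by near=> n => /=; rewrite -cs_starB cs_norm_star mul1r.
Unshelve. all: by end_near. Qed.

Lemma cnorm_pi s : (fun n => N (s n)) @ \oo --> cnorm (\pi_Q s).
Proof.
have cr := cs_cauchy_norm (cseqP (repr (\pi_Q s))).
have := repr_null s => /cs_nullP n0.
apply/cvgrPdist_le => e e0.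
have e2 : 0 < e / 2 by rewrite divr_gt0.
have /cvgrPdist_le/(_ _ e2) h1 := cr.
have /cvgrPdist_le/(_ _ e2) h2 := n0.
near=> n.
have : `|cnorm (\pi_Q s) - N (repr (\pi_Q s) n)| <= e / 2 by near: n.
have : `|0 - N (s n - repr (\pi_Q s) n)| <= e / 2 by near: n.
rewrite sub0r normrN ger0_norm ?cs_norm_ge0// => k1 k2.
have := cs_norm_dist (s n) (repr (\pi_Q s) n) => k3.
have -> : cnorm (\pi_Q s) - N (s n) = (cnorm (\pi_Q s) - N (repr (\pi_Q s) n)) -
   (N (s n) - N (repr (\pi_Q s) n)) by ring.
apply: le_trans (ler_normB _ _) _.
by rewrite [leRHS]splitr lerD// (le_trans k3).
Unshelve. all: by end_near. Qed.

Arguments cnorm_pi : clear implicits.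

Lemma cscaleA c d p : cscale c (cscale d p) = cscale (c * d) p.
Proof.
have [s ->] := cpiP p; rewrite !piZ; apply/pi_eq => e e0; exists 0%N => n _ /=.
by rewrite scalerA subrr cs_norm0.
Qed.

Lemma cscale1 : left_id 1 cscale.
Proof.
move=> p; have [s ->] := cpiP p; rewrite !piZ; apply/pi_eq => e e0; exists 0%N => n _ /=.
by rewrite scale1r subrr cs_norm0.
Qed.

Lemma cscaleDr : right_distributive cscale +%R.
Proof.
move=> c p q; have [s ->] := cpiP p; have [t ->] := cpiP q.
rewrite -piD !piZ -piD; apply/pi_eq => e e0; exists 0%N => n _ /=.
by rewrite scalerDr subrr cs_norm0.
Qed.

Lemma cscaleDl p : {morph cscale^~ p : c d / c + d}.
Proof.
move=> c d; have [s ->] := cpiP p.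
rewrite !piZ -piD; apply/pi_eq => e e0; exists 0%N => n _ /=.
by rewrite scalerDl subrr cs_norm0.
Qed.

HB.instance Definition _ := GRing.Zmodule_isLmodule.Build R[i] completion_type
  cscaleA cscale1 cscaleDr cscaleDl.

Lemma pi_scale c s : c *: \pi_Q s = \pi_Q (mk_cseq (cs_cauchyZ c (cseqP s))).
Proof. exact: piZ. Qed.

Lemma pi_seq s t : (forall n, s n = t n) -> \pi_Q s = \pi_Q t.
Proof.
by move=> st; apply/pi_eq => e e0; exists 0%N => n _; rewrite st subrr cs_norm0.
Qed.

Lemma cmulA : associative cmul.
Proof.
move=> p q r; have [s ->] := cpiP p; have [t ->] := cpiP q; have [v ->] := cpiP r.
by rewrite !piM; apply: pi_seq => n /=; rewrite cs_mulA.
Qed.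

Lemma cmulDl : left_distributive cmul +%R.
Proof.
move=> p q r; have [s ->] := cpiP p; have [t ->] := cpiP q; have [v ->] := cpiP r.
by rewrite -piD !piM -piD; apply: pi_seq => n /=; rewrite cs_mulDl.
Qed.

Lemma cmulDr : right_distributive cmul +%R.
Proof.
move=> p q r; have [s ->] := cpiP p; have [t ->] := cpiP q; have [v ->] := cpiP r.
by rewrite -piD !piM -piD; apply: pi_seq => n /=; rewrite cs_mulDr.
Qed.

Lemma cmulZl c p q : cmul (c *: p) q = c *: cmul p q.
Proof.
have [s ->] := cpiP p; have [t ->] := cpiP q; rewrite !(pi_scale, piM).
by apply: pi_seq => n /=; rewrite cs_mulZl.
Qed.

Lemma cmulZr c p q : cmul p (c *: q) = c *: cmul p q.
Proof.
have [s ->] := cpiP p; have [t ->] := cpiP q; rewrite !(pi_scale, piM).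
by apply: pi_seq => n /=; rewrite cs_mulZr.
Qed.

Lemma cstarK : involutive cstar.
Proof.
move=> p; have [s ->] := cpiP p; rewrite !pi_star.
by apply: pi_seq => n /=; rewrite cs_starK.
Qed.

Lemma cstarD : {morph cstar : p q / p + q}.
Proof.
move=> p q; have [s ->] := cpiP p; have [t ->] := cpiP q.
by rewrite -piD !pi_star -piD; apply: pi_seq => n /=; rewrite cs_starD.
Qed.

Lemma cstarZ c p : cstar (c *: p) = c^* *: cstar p.
Proof.
have [s ->] := cpiP p; rewrite pi_star !pi_scale pi_star.
by apply: pi_seq => n /=; rewrite cs_starZ.
Qed.

Lemma cstarM p q : cstar (cmul p q) = cmul (cstar q) (cstar p).
Proof.
have [s ->] := cpiP p; have [t ->] := cpiP q; rewrite !(pi_star, piM).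
by apply: pi_seq => n /=; rewrite cs_starM.
Qed.

Lemma cnormE s (l : R) : (fun n => N (s n)) @ \oo --> l -> cnorm (\pi_Q s) = l.
Proof.
move=> h; have c := cnorm_pi s.
by rewrite -(cvg_lim (@Rhausdorff R) c) (cvg_lim (@Rhausdorff R) h).
Qed.

Lemma cnormD p q : cnorm (p + q) <= cnorm p + cnorm q.
Proof.
have [s ->] := cpiP p; have [t ->] := cpiP q; rewrite -piD.
apply: ler_cvg_to (cnorm_pi (s + t)) (cvgD (cnorm_pi s) (cnorm_pi t)) _.
by near=> n; apply: cs_normD.
Unshelve. all: by end_near. Qed.

Lemma cnormZ c p : cnorm (c *: p) = cabs c * cnorm p.
Proof.
have [s ->] := cpiP p; rewrite pi_scale; apply: cnormE => /=.
under eq_fun do rewrite cs_normZ.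
exact: cvgMr (cnorm_pi s).
Qed.

Lemma cnormM p q : cnorm (cmul p q) <= cnorm p * cnorm q.
Proof.
have [s ->] := cpiP p; have [t ->] := cpiP q; rewrite piM.
apply: ler_cvg_to (cnorm_pi _) (cvgM (cnorm_pi s) (cnorm_pi t)) _.
by near=> n; apply: cs_normM.
Unshelve. all: by end_near. Qed.

Lemma cnorm_cstar p : cnorm (cmul (cstar p) p) = cnorm p ^+ 2.
Proof.
have [s ->] := cpiP p; rewrite pi_star piM; apply: cnormE => /=.
under eq_fun do rewrite cs_norm_cstar.
by under eq_fun do rewrite expr2; rewrite expr2; apply: cvgM; exact: cnorm_pi.
Qed.

Definition completion_pre : preCstarAlgebra R :=
  PreCstarAlgebra cmulA cmulDl cmulDr cmulZl cmulZr cstarK cstarD cstarZ cstarM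
    cnormD cnormZ cnormM cnorm_cstar.

Lemma cnorm_eq0 p : cnorm p = 0 -> p = 0.
Proof.
have [s ->] := cpiP p => h.
have n0 : cs_null (cseq_fun s) by apply/cs_nullP; rewrite -h; exact: cnorm_pi.
rewrite -(subrr (\pi_Q s)) -piB; apply/pi_eq.
by move=> e /n0[K hK]; exists K => n Kn; rewrite [X in X n]/= subrr subr0 hK.
Qed.

Lemma cnorm_le s (e : R) : (\forall n \near \oo, N (s n) <= e) -> cnorm (\pi_Q s) <= e.
Proof.
move=> h; have c := cnorm_pi s.
rewrite -(cvg_lim _ c)//; apply: limr_le; first exact: cvgP c.
exact: h.
Qed.

Lemma completion_complete (u : nat -> completion_pre) :
  cs_cauchy u -> exists l, cs_cvg u l.
Proof.
move=> cu.
have hk m : exists k, forall i j, (k <= i)%N -> (k <= j)%N ->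
    N (repr (u m) i - repr (u m) j) < m.+1%:R^-1.
  by apply: cseqP; rewrite invr_gt0.
have [k hkk] := choice hk.
pose v m := repr (u m) (k m).
have arch (e : R) : 0 < e -> exists K, forall m, (K <= m)%N -> m.+1%:R^-1 < e.
  move=> e0; exists (Num.trunc e^-1) => m Km.
  rewrite invf_plt ?posrE//; apply: lt_le_trans (truncnS_gt _) _.
  by rewrite ler_nat ltnS.
have upi m : u m = \pi_Q (repr (u m)) by rewrite reprK.
have cv : cs_cauchy v.
  move=> e e0; have e4 : 0 < e / 4 by rewrite divr_gt0.
  have [K1 h1] := cu _ e4; have [K2 h2] := arch _ e4.
  exists (maxn K1 K2) => m n; rewrite !geq_max => /andP[K1m K2m] /andP[K1n K2n].
  have h3 : cnorm (\pi_Q (repr (u m) - repr (u n))) < e / 4.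
    by rewrite piB !reprK; exact: h1.
  have c3 := cnorm_pi (repr (u m) - repr (u n)).
  have /cvgrPdist_lt/(_ _ e4)[K3 _ h4] := c3.
  pose i := maxn K3 (maxn (k m) (k n)).
  have := h4 i (leq_maxl _ _); rewrite ltr_norml => /andP[h5 _].
  have km : (k m <= i)%N by rewrite /i !leq_max leqnn !orbT.
  have kn : (k n <= i)%N by rewrite /i !leq_max leqnn !orbT.
  have a1 := hkk m (k m) i (leqnn _) km.
  have a2 := hkk n i (k n) kn (leqnn _).
  have a3 := h2 _ K2m; have a4 := h2 _ K2n.
  have t1 := cs_norm_tri (v m) (repr (u m) i) (v n).
  have t2 := cs_norm_tri (repr (u m) i) (repr (u n) i) (v n).
  have h6 : N (repr (u m) i - repr (u n) i) =
    N ((repr (u m) - repr (u n)) i) by [].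
  have h7 : N (repr (u m) i - repr (u n) i) < e / 2 by rewrite h6; lra.
  rewrite -/(v m) -/(v n) in a1 a2.
  apply: le_lt_trans t1 _; apply: le_lt_trans (lerD (lexx _) t2) _.
  have -> : e = e / 4 + (e / 2 + e / 4) by lra.
  by rewrite ltrD ?ltrD// ?(lt_trans a1)// ?(lt_trans a2).
exists (\pi_Q (mk_cseq cv)) => e e0.
have e4 : 0 < e / 4 by rewrite divr_gt0.
have [K1 h1] := cv _ e4; have [K2 h2] := arch _ e4.
exists (maxn K1 K2) => n; rewrite !geq_max => /andP[K1n K2n].
rewrite /= upi -piB; apply: (@le_lt_trans _ _ (e / 2)); last by lra.
apply: cnorm_le; exists (maxn K1 (k n)) => // i; rewrite /= geq_max => /andP[K1i kni].
have a1 := hkk n i (k n) kni (leqnn _).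
have a2 := h1 n i K1n K1i; have a3 := h2 _ K2n.
have t1 := cs_norm_tri (repr (u n) i) (v n) (v i).
have h6 : N ((repr (u n) - mk_cseq cv) i) = N (repr (u n) i - v i) by [].
rewrite -/(v n) in a1; rewrite h6; apply: le_trans t1 _.
have -> : e / 2 = e / 4 + e / 4 by lra.
by rewrite lerD ?ltW// (lt_trans a1).
Qed.

Definition completion : cstarAlgebra R :=
  @CstarAlgebra R completion_pre cnorm_eq0 completion_complete.

End PreCstarTheory.

Definition twisted_group_cstar (R : realType) (G : zmodType) (w : multiplier R G) : cstarAlgebra R :=
  completion (l1_algebra w).

Section PadicRationals.
Variable p : nat.

Definition is_pfrac (x : rat) (j : int) (k : nat) : Prop :=
  x = j%:~R / p%:R ^+ k.

Definition pfrac_pred : {pred rat} := [pred x | `[< exists j k, is_pfrac x j k >]].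

Lemma pfrac_zmod_closed : zmod_closed pfrac_pred.
Proof.
split=> [|x y /asboolP[j [k ->]] /asboolP[j' [k' ->]]]; apply/asboolP.
  by exists 0, 0%N; rewrite /is_pfrac mul0r.
have [p0|p0] := eqVneq (p%:R : rat) 0.
  exists (j *+ (k == 0%N) - j' *+ (k' == 0%N)), 0%N.
  rewrite /is_pfrac p0 expr0 divr1 rmorphB /= !rmorphMn /= !expr0n.
  by case: (k == 0%N); case: (k' == 0%N); rewrite ?invr0 ?invr1 ?mulr0 ?mulr1.
exists (j * p%:Z ^+ k' - j' * p%:Z ^+ k), (k + k')%N.
rewrite /is_pfrac rmorphB !rmorphM /= !rmorphXn /= exprD.
have hk := expf_neq0 k p0; have hk' := expf_neq0 k' p0.
by rewrite -pmulrn; field; rewrite hk hk'.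
Qed.

HB.instance Definition _ :=
  GRing.isZmodClosed.Build rat pfrac_pred pfrac_zmod_closed.

(* Z[1/p], as a subgroup of the rationals. *)
Record pfrac := Pfrac { pfrac_val :> rat; pfrac_valP : pfrac_val \in pfrac_pred }.
HB.instance Definition _ := [isSub for pfrac_val].
HB.instance Definition _ := [Choice of pfrac by <:].
HB.instance Definition _ := [SubChoice_isSubZmodule of pfrac by <:].

Lemma pfrac_expo_ex (x : pfrac) : exists k, `[< exists j, is_pfrac x j k >].
Proof. by have /asboolP[j [k h]] := pfrac_valP x; exists k; apply/asboolP; exists j. Qed.

(* x = numer x / p ^ expo x with expo x minimal; see is_pfrac_numer, expo_min. *)
Definition expo (x : pfrac) : nat := ex_minn (pfrac_expo_ex x).
Definition numer (x : pfrac) : int := numq (pfrac_val x * p%:R ^+ expo x).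

Definition Gamma : zmodType := (pfrac * pfrac)%type.

Hypothesis p_gt1 : (1 < p)%N.

Lemma pN0 : (p%:R : rat) != 0.
Proof. by rewrite pnatr_eq0 -lt0n ltnW. Qed.

Lemma is_pfrac_numer (x : pfrac) : is_pfrac x (numer x) (expo x).
Proof.
rewrite /numer /expo; case: ex_minnP => k /asboolP[j hj] _.
have hk := expf_neq0 k pN0.
by rewrite {2}hj divfK// numq_int.
Qed.

Lemma expo_min (x : pfrac) j k : is_pfrac x j k -> (expo x <= k)%N.
Proof.
by move=> h; rewrite /expo; case: ex_minnP => m _; apply; apply/asboolP; exists j.
Qed.

Lemma pfrac_rescale (x : pfrac) j k : is_pfrac x j k ->
  exists d, k = (expo x + d)%N /\ j = numer x * p%:Z ^+ d.
Proof.
move=> h; exists (k - expo x)%N; have le := expo_min h.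
rewrite subnKC//; split=> //.
have := is_pfrac_numer x; rewrite /is_pfrac h => e.
apply/eqP; rewrite -(eqr_int rat) rmorphM rmorphXn /=.
have hk := expf_neq0 k pN0; have hx := expf_neq0 (expo x) pN0.
move/eqP: e; rewrite eqr_div// => /eqP e.
apply/eqP/(mulIf hx);
by rewrite e -mulrA -pmulrn -exprD subnK.
Qed.

End PadicRationals.

Section Multipliers.
Variables (R : realType) (p : nat).
Implicit Type alpha : nat -> R.

Definition Omega_even alpha : Prop :=
  forall n, exists x : int, p%:R * alpha n.+1 = alpha n + (2 * x)%:~R.

(* exp(i t). *)
Definition expi (t : R) : R[i] := cos t +i* sin t.

(* The number alpha_(k+l) j m attached to x = j/p^k and y = m/p^l. *)
Definition pairing alpha (x y : pfrac p) : R :=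
  alpha (expo x + expo y)%N * (numer x)%:~R * (numer y)%:~R.

Definition Psi_fun alpha (s t : Gamma p) : R[i] :=
  expi (2 * pi * pairing alpha s.1 t.2).

Definition omega_fun alpha (s t : Gamma p) : R[i] :=
  expi (pi * (pairing alpha s.1 t.2 - pairing alpha s.2 t.1)).

Lemma expiD t u : expi (t + u) = expi t * expi u.
Proof. by rewrite /expi cosD sinD; apply/eqP; rewrite eq_complex /= [_ * sin u + _]addrC !eqxx. Qed.

Lemma expi0 : expi 0 = 1.
Proof. by rewrite /expi cos0 sin0. Qed.

Lemma norm_expi t : `|expi t| = 1.
Proof. by rewrite normc_def /= cos2Dsin2 sqrtr1. Qed.

Lemma even_intN (z : int) : (2 * - z)%:~R = - (2 * z)%:~R :> R.
Proof. by rewrite (mulrN 2 z) mulrNz. Qed.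

Lemma expi_2pi (z : int) t : expi (t + pi * (2 * z)%:~R) = expi t.
Proof.
have e1 : expi (pi * 2%:~R) = 1.
  by rewrite /expi mulrzr -pmulrn cos2pi sin2pi.
have en (n : nat) : expi (pi * (2 * n%:Z)%:~R) = 1.
  elim: n => [|n IH]; first by rewrite mulr0 expi0.
  by rewrite intS mulrDr mulr1 rmorphD mulrDr expiD IH e1 mulr1.
rewrite expiD; case: z => n; first by rewrite en mulr1.
rewrite NegzE even_intN mulrN.
have := expiD (- (pi * (2 * n.+1%:Z)%:~R)) (pi * (2 * n.+1%:Z)%:~R).
by rewrite addNr expi0 en mulr1 => <-; rewrite mulr1.
Qed.

Definition congr2 (a b : R) := exists z : int, a = b + (2 * z)%:~R.

Lemma congr2_refl a : congr2 a a.
Proof. by exists 0; rewrite mulr0 addr0. Qed.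

Lemma congr2_trans b a c : congr2 a b -> congr2 b c -> congr2 a c.
Proof.
by move=> [z ->] [z' ->]; exists (z' + z); rewrite mulrDr rmorphD addrA.
Qed.

Lemma congr2_sym a b : congr2 a b -> congr2 b a.
Proof. by move=> [z ->]; exists (- z); rewrite even_intN addrK. Qed.

Lemma congr2Z (j : int) a b : congr2 a b -> congr2 (j%:~R * a) (j%:~R * b).
Proof.
by move=> [z ->]; exists (j * z); rewrite mulrDr mulrCA [in RHS]rmorphM.
Qed.

Lemma congr2D a b c d : congr2 a b -> congr2 c d -> congr2 (a + c) (b + d).
Proof.
by move=> [z ->] [z' ->]; exists (z + z'); rewrite mulrDr rmorphD addrACA.
Qed.

Lemma congr2N a b : congr2 a b -> congr2 (- a) (- b).
Proof. by move=> [z ->]; exists (- z); rewrite even_intN opprD. Qed.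

Lemma expi_congr2 a b : congr2 a b -> expi (pi * a) = expi (pi * b).
Proof. by move=> [z ->]; rewrite mulrDr expi_2pi. Qed.

Hypothesis p_gt1 : (1 < p)%N.
Variable alpha : nat -> R.
Hypothesis alphaP : Omega_even alpha.

Lemma alpha_shift n d : congr2 ((p%:Z ^+ d)%:~R * alpha (n + d)%N) (alpha n).
Proof.
elim: d => [|d IH]; first by rewrite expr0 mul1r addn0; exact: congr2_refl.
apply: congr2_trans IH; rewrite exprSr rmorphM -mulrA addnS.
by apply: congr2Z; have [x hx] := alphaP (n + d)%N; exists x; rewrite -hx.
Qed.

Lemma pairing_rep (x y : pfrac p) j k j' k' :
  is_pfrac p x j k -> is_pfrac p y j' k' ->
  congr2 (alpha (k + k')%N * j%:~R * j'%:~R) (pairing alpha x y).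
Proof.
move=> /(pfrac_rescale p_gt1)[d [-> ->]] /(pfrac_rescale p_gt1)[d' [-> ->]].
rewrite /pairing.
have := congr2Z (numer x * numer y) (alpha_shift (expo x + expo y)%N (d + d')%N).
congr congr2; last by rewrite rmorphM; ring.
by rewrite exprD addnACA !rmorphM; ring.
Qed.

Lemma pairingDl x x' y :
  congr2 (pairing alpha (x + x') y) (pairing alpha x y + pairing alpha x' y).
Proof.
have hx := is_pfrac_numer p_gt1 x; have hx' := is_pfrac_numer p_gt1 x'.
have hy := is_pfrac_numer p_gt1 y; have pn := pN0 p_gt1.
set k := expo x in hx *; set k' := expo x' in hx' *.
pose J := numer x * p%:Z ^+ k'; pose J' := numer x' * p%:Z ^+ k.
have ek := expf_neq0 k pn; have ek' := expf_neq0 k' pn.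
have h1 : is_pfrac p x J (k + k')%N.
  by rewrite {1}hx /is_pfrac rmorphM rmorphXn /= exprD -pmulrn -mulf_div divff// mulr1.
have h2 : is_pfrac p x' J' (k + k')%N.
  by rewrite {1}hx' /is_pfrac rmorphM rmorphXn /= addnC exprD -pmulrn -mulf_div divff// mulr1.
have h3 : is_pfrac p (x + x' : pfrac p) (J + J') (k + k')%N.
  by rewrite /is_pfrac rmorphD mulrDl -h1 -h2.
apply: congr2_trans (congr2_sym (pairing_rep h3 hy)) _.
apply: congr2_trans (congr2D (pairing_rep h1 hy) (pairing_rep h2 hy)).
have -> : alpha (k + k' + expo y)%N * (J + J')%:~R * (numer y)%:~R =
   alpha (k + k' + expo y)%N * J%:~R * (numer y)%:~R +
   alpha (k + k' + expo y)%N * J'%:~R * (numer y)%:~R by rewrite rmorphD /=; ring.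
exact: congr2_refl.
Qed.

Lemma pairingC x y : pairing alpha x y = pairing alpha y x.
Proof. by rewrite /pairing addnC mulrAC. Qed.

Lemma pairingDr x y y' :
  congr2 (pairing alpha x (y + y')) (pairing alpha x y + pairing alpha x y').
Proof. rewrite pairingC [pairing _ x y]pairingC [pairing _ x y']pairingC; exact: pairingDl. Qed.

Lemma pairing0 x : pairing alpha x 0 = 0.
Proof.
rewrite /pairing (_ : numer 0 = 0) ?mulr0//.
have := is_pfrac_numer p_gt1 (0 : pfrac p); rewrite /is_pfrac /= => /esym/eqP.
rewrite mulf_eq0 invr_eq0 expf_eq0 (negPf (pN0 p_gt1)) andbF orbF.
by rewrite intr_eq0 => /eqP.
Qed.

Lemma bicharacter_is_multiplier (b : Gamma p -> Gamma p -> R) :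
  (forall s s' t, congr2 (b (s + s') t) (b s t + b s' t)) ->
  (forall s t t', congr2 (b s (t + t')) (b s t + b s t')) ->
  (forall s, b s 0 = 0) -> (forall s, b 0 s = 0) ->
  is_multiplier (fun s t => expi (pi * b s t)).
Proof.
move=> bDl bDr b0 b0'; split=> [s t|s t u|s|s].
- exact: norm_expi.
- rewrite -!expiD -!mulrDr; apply: expi_congr2.
  apply: congr2_trans (congr2D (congr2_refl _) (bDl s t u)) _; rewrite addrA.
  apply: congr2_sym; exact: congr2D (bDr s t u) (congr2_refl _).
- by rewrite b0 mulr0 expi0.
- by rewrite b0' mulr0 expi0.
Qed.

Lemma Psi_is_multiplier : is_multiplier (Psi_fun alpha).
Proof.
have -> : Psi_fun alpha = fun s t => expi (pi * (2%:~R * pairing alpha s.1 t.2)).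
  by apply/funext => s; apply/funext => t; rewrite mulrCA mulrA.
apply: bicharacter_is_multiplier => [s s' t|s t t'|s|s] /=.
- by rewrite -mulrDr; apply: congr2Z; exact: pairingDl.
- by rewrite -mulrDr; apply: congr2Z; exact: pairingDr.
- by rewrite pairing0 mulr0.
- by rewrite pairingC pairing0 mulr0.
Qed.

Lemma omega_is_multiplier : is_multiplier (omega_fun alpha).
Proof.
apply: bicharacter_is_multiplier => [s s' t|s t t'|s|s] /=.
- rewrite addrACA -opprD; apply: congr2D; first exact: pairingDl.
  by apply: congr2N; exact: pairingDl.
- rewrite addrACA -opprD; apply: congr2D; first exact: pairingDr.
  by apply: congr2N; exact: pairingDr.
- by rewrite !pairing0 subr0.
- by rewrite pairingC pairing0 pairingC pairing0 subr0.
Qed.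

Definition Psi : multiplier R (Gamma p) := Multiplier Psi_is_multiplier.
Definition omega : multiplier R (Gamma p) := Multiplier omega_is_multiplier.

End Multipliers.

(* Main.v *)
Require Import Defs.
From mathcomp Require Import all_boot all_order all_algebra reals.
From mathcomp Require Import boolp complex generic_quotient trigo ring.

(** Put [q s = pairing s.1 s.2]. Biadditivity and symmetry of [pairing] modulo 2
    give [q (s + t) = q s + q t + pairing s.1 t.2 + pairing s.2 t.1] modulo 2, so
    [rho s = exp (- pi i q s)] satisfies [Psi = d rho * omega]. For any
    cohomologous multipliers, pointwise multiplication by [rho] is unitary on
    [l^2(G)] and intertwines the twisted convolutions on [l^1(G)] and [l^2(G)];
    hence it is an isometric *-isomorphism of the [l^1] algebras, and extends to
    the completions. *)

Set Implicit Arguments.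
Unset Strict Implicit.
Unset Printing Implicit Defensive.

Import Order.TTheory GRing.Theory Num.Theory.

Local Open Scope ring_scope.

(** * Extension of isometric *-isomorphisms to completions *)

Section CompletionIso.
Local Open Scope quotient_scope.
Variables (R : realType) (A B : preCstarAlgebra R) (phi : A -> B).

Hypothesis phi_lin : linear phi.
Hypothesis phi_isom : forall a, cs_norm (phi a) = cs_norm a.

Let phiB a b : phi (a - b) = phi a - phi b.
Proof. by rewrite addrC -scaleN1r phi_lin scaleN1r addrC. Qed.

Lemma isometry_cauchy (u : nat -> A) :
  cs_cauchy u <-> cs_cauchy (fun n => phi (u n)).
Proof.
by split=> cu e /cu[K hK]; exists K => m n Km Kn; have := hK m n Km Kn;
  rewrite -phiB phi_isom.
Qed.

Lemma isometry_null (u : nat -> A) :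
  cs_null u <-> cs_null (fun n => phi (u n)).
Proof.
by split=> cu e /cu[K hK]; exists K => n Kn; have := hK n Kn; rewrite phi_isom.
Qed.

Definition cseq_map (s : cseq A) : cseq B :=
  mk_cseq ((isometry_cauchy s).1 (cseqP s)).

(** Defined on a chosen representative; [completion_map_pi] shows that any other gives the same
    class. *)
Definition completion_map (x : completion_type A) : completion_type B :=
  \pi_(completion_type B) (cseq_map (repr x)).

Lemma cseq_map_null (s t : cseq A) :
  cs_null (fun n => cseq_map s n - cseq_map t n) <-> cs_null (fun n => s n - t n).
Proof.
rewrite isometry_null.
by under [X in _ <-> cs_null X]eq_fun do rewrite phiB.
Qed.

Lemma completion_map_pi (s : cseq A) :
  completion_map (\pi_(completion_type A) s) = \pi_(completion_type B) (cseq_map s).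
Proof. by apply/esym/pi_eq/cseq_map_null; exact: repr_null. Qed.

(** An isometry reflects null sequences as well as preserving them. *)
Lemma completion_map_inj : injective completion_map.
Proof.
move=> x y; have [s ->] := cpiP x; have [t ->] := cpiP y.
by rewrite !completion_map_pi => /pi_eq/cseq_map_null/pi_eq.
Qed.

Lemma completion_star_isomorphic :
  bijective phi ->
  {morph phi : a b / cs_mul a b} -> {morph phi : a / cs_star a} ->
  star_isomorphic (completion A) (completion B).
Proof.
move=> [psi phiK psiK] phiM phi_star; exists completion_map; split.
- have surj (y : completion_type B) : exists x, completion_map x = y.
    have [t ->] := cpiP y.
    (* A preimage is obtained by applying [psi] termwise; it is Cauchy because [phi] reflects Cauchy
       sequences. *)
    have cu : cs_cauchy (fun n => psi (t n)).
      apply/isometry_cauchy; under eq_fun do rewrite psiK.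
      exact: cseqP.
    exists (\pi_(completion_type A) (mk_cseq cu)); rewrite completion_map_pi.
    by apply: pi_seq => n /=; rewrite psiK.
  have [g gK] := choice surj; exists g => // x.
  by apply: completion_map_inj; rewrite gK.
- move=> c x y; have [s ->] := cpiP x; have [t ->] := cpiP y.
  rewrite pi_scale -piD !completion_map_pi pi_scale -piD.
  by apply: pi_seq => n; exact: phi_lin.
- move=> x y; have [s ->] := cpiP x; have [t ->] := cpiP y.
  rewrite /= piM !completion_map_pi piM.
  by apply: pi_seq => n; exact: phiM.
- move=> x; have [s ->] := cpiP x.
  rewrite /= pi_star !completion_map_pi pi_star.
  by apply: pi_seq => n; exact: phi_star.
Qed.

End CompletionIso.

(** * From a coboundary to an isomorphism of twisted group algebras *)

Section CohomologousIso.
Variables (R : realType) (G : zmodType).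
Implicit Types (w : multiplier R G) (rho f : G -> R[i]).

Definition cobounds rho w w' : Prop :=
  (forall s, `|rho s| = 1) /\
  forall s t, w s t = rho s * rho t * conjc (rho (s + t)) * w' s t.

Lemma unimodular_cabs rho s : (forall s, `|rho s| = 1) -> cabs (rho s) = 1.
Proof. by move=> h; rewrite /cabs h. Qed.

Lemma unimodularJ rho s :
  (forall s, `|rho s| = 1) -> rho s * conjc (rho s) = 1.
Proof. by move=> h; rewrite mulcJ unimodular_cabs// expr1n. Qed.

(** Supplies the inverse isomorphism and the reverse norm inequality. *)
Lemma cobounds_sym rho w w' :
  cobounds rho w w' -> cobounds (fun s => conjc (rho s)) w' w.
Proof.
move=> [r1 e]; split=> [s|s t].
  by rewrite -cabsE cabs_conj unimodular_cabs.
rewrite e conjcK.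
transitivity ((rho s * conjc (rho s)) * (rho t * conjc (rho t)) *
  (rho (s + t) * conjc (rho (s + t))) * w' s t); last by ring.
by rewrite !unimodularJ// !mul1r.
Qed.

(** In the term at [y], the factor [rho y * rho (x - y)] is absorbed by [f] and [g], and
    [conjc (rho x)] cancels the outer [rho x]. Boundedness of [g] covers both the product of [l1]
    and the action on square-summable functions. *)
Lemma conv_cobounds rho w w' f g : cobounds rho w w' ->
  csummable f -> ubounded g ->
  conv w' (fun x => rho x * f x) (fun x => rho x * g x) =
  (fun x => rho x * conv w f g x).
Proof.
move=> [r1 e] sf bg; apply/funext => x; rewrite /conv -csumZ; last exact: bounded_term.
congr csum; apply/funext => y; rewrite e [y + _]addrC subrK.
transitivity ((rho x * conjc (rho x)) *
  (rho y * f y * (rho (x - y) * g (x - y)) * w' y (x - y))); last by ring.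
by rewrite unimodularJ// mul1r.
Qed.

Lemma conv_star_cobounds rho w w' f : cobounds rho w w' ->
  conv_star w' (fun x => rho x * f x) = (fun x => rho x * conv_star w f x).
Proof.
move=> [r1 e]; apply/funext => x; rewrite /conv_star e subrr.
(* The coboundary identity at [(0, 0)] reads [1 = rho 0 * rho 0 * conjc (rho 0)]. *)
have r0 : rho 0 = 1.
  by have := e 0 0; rewrite !w0r addr0 mulr1 -mulrA unimodularJ// mulr1 => <-.
rewrite r0 rmorph1 mulr1 !rmorphM /=.
transitivity ((rho x * conjc (rho x)) *
  (conjc (w' x (- x)) * (conjc (rho (- x)) * conjc (f (- x))))); last by ring.
by rewrite unimodularJ// mul1r.
Qed.

Lemma csummable_phase rho f : (forall s, `|rho s| = 1) -> csummable f ->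
  csummable (fun x => rho x * f x).
Proof.
move=> r1 sf; rewrite /csummable.
by under eq_fun do rewrite cabsM unimodular_cabs// mul1r.
Qed.

Lemma l2_phase rho f : (forall s, `|rho s| = 1) ->
  (square_summable (fun x => rho x * f x) <-> square_summable f) /\
  l2norm (fun x => rho x * f x) = l2norm f.
Proof.
move=> r1; rewrite /square_summable /l2norm.
by under eq_fun do rewrite cabsM unimodular_cabs// mul1r.
Qed.

(** Multiplication by [rho] preserves [l2norm] and turns convolution by [f] into [w']-convolution by
    [rho * f]. *)
Lemma regular_norm_cobounds_le rho w w' f : cobounds rho w w' -> csummable f ->
  regular_norm w f <= regular_norm w' (fun x => rho x * f x).
Proof.
move=> e sf; have [r1 _] := e; have srf := csummable_phase r1 sf.
apply: regular_norm_le => [//||xi sx]; first exact: regular_norm_ge0.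
have [i1 n1] := l2_phase xi r1; rewrite -n1.
have [_ <-] := l2_phase (conv w f xi) r1.
rewrite -(conv_cobounds e)//; last exact: l2_bounded.
by apply: conv_le => //; apply/i1.
Qed.

Lemma conj_phaseK rho f : (forall s, `|rho s| = 1) ->
  (fun x => conjc (rho x) * (rho x * f x)) = f.
Proof.
by move=> r1; apply/funext => x; rewrite mulrA [conjc _ * _]mulrC unimodularJ// mul1r.
Qed.

Lemma regular_norm_cobounds rho w w' f : cobounds rho w w' -> csummable f ->
  regular_norm w' (fun x => rho x * f x) = regular_norm w f.
Proof.
move=> e sf; have [r1 _] := e.
have le := regular_norm_cobounds_le e sf.
have := regular_norm_cobounds_le (cobounds_sym e) (csummable_phase r1 sf).
rewrite (conj_phaseK f r1) => ge.
by apply: le_anti; apply/andP; split; [exact: ge|exact: le].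
Qed.

Definition l1_phase rho (r1 : forall s, `|rho s| = 1) (f : l1 R G) : l1 R G :=
  mk_l1 (csummable_phase r1 (l1P f)).

Lemma cohomologous_star_isomorphic w w' : cohomologous w w' ->
  star_isomorphic (twisted_group_cstar w) (twisted_group_cstar w').
Proof.
move=> [rho [r1 ew]]; have e : cobounds rho w w' by [].
have [r1' _] := cobounds_sym e.
apply: (@completion_star_isomorphic R (l1_algebra w) (l1_algebra w') (l1_phase r1)).
- move=> c f g; apply: l1_eq; apply/funext => x.
  exact: etrans (mulrDr _ _ _) (congr1 (+%R^~ _) (mulrCA _ _ _)).
- by move=> f; exact: (regular_norm_cobounds e (l1P f)).
- exists (l1_phase r1') => f; apply: l1_eq => /=; first exact: conj_phaseK.
  have := @conj_phaseK (fun x => conjc (rho x)) f r1'.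
  by under eq_fun do rewrite conjcK.
- move=> f g; apply: l1_eq => /=.
  by rewrite (conv_cobounds e (l1P f) (l1_ubounded g)).
- by move=> f; apply: l1_eq; exact/esym/(conv_star_cobounds f e).
Qed.

End CohomologousIso.

(** * The explicit coboundary between [Psi] and [omega] *)

Lemma conj_expi (R : realType) (t : R) : conjc (expi t) = expi (- t).
Proof. by rewrite /expi cosN sinN. Qed.

Lemma Psi_omega_cohomologous (R : realType) (p : nat) (hp : (1 < p)%N)
    (alpha : nat -> R) (halpha : Omega_even p alpha) :
  cohomologous (Psi hp halpha) (omega hp halpha).
Proof.
pose q (s : Gamma p) := pairing alpha s.1 s.2.
exists (fun s => expi (pi * - q s)); split=> [s|s t]; first exact: norm_expi.
rewrite conj_expi -[Psi _ _ _ _]/(Psi_fun alpha s t).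
rewrite -[omega _ _ _ _]/(omega_fun alpha s t) /Psi_fun /omega_fun -!expiD -(mulrN pi) opprK -!mulrDr.
(* With [pi] factored out of both exponents, agreement modulo 2 suffices, which is the precision
   that [Omega_even] gives for [pairing]. *)
rewrite [2 * pi]mulrC -mulrA; apply: expi_congr2.
have q_add : Defs.congr2 (q (s + t))
    ((q s + pairing alpha s.1 t.2) + (pairing alpha t.1 s.2 + q t)).
  apply: congr2_trans (pairingDl hp halpha _ _ _) _.
  by apply: congr2D; exact: pairingDr.
(* After cancelling [q s] and [q t], symmetry of [pairing] removes the terms in [s.2] and [t.1],
   leaving twice [pairing alpha s.1 t.2], the exponent of [Psi]. *)
have := congr2D (congr2D (congr2_refl (- q s + - q t)) (congr2_sym q_add))
  (congr2_refl (pairing alpha s.1 t.2 - pairing alpha s.2 t.1)).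
by congr Defs.congr2; rewrite [pairing _ t.1 _]pairingC; ring.
Qed.

Theorem lemma3p4 (R : realType) (p : nat) (hp : (1 < p)%N)
    (alpha : nat -> R) (halpha : Omega_even p alpha) :
  cohomologous (Psi hp halpha) (omega hp halpha) /\
  star_isomorphic (twisted_group_cstar (Psi hp halpha))
    (twisted_group_cstar (omega hp halpha)).
Proof.
have coh := Psi_omega_cohomologous hp halpha.
by split=> //; exact: cohomologous_star_isomorphic.
Qed.
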